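(* Let $F$ be a non-Archimedean local field and $E=F\times E'$ with $E'/F$ an unramified quadratic field extension. For integers $a,b\ge0$ and $c\in\mathfrak o$ let $\mathcal O_{a,b,c}$ be the $\mathfrak o$-submodule of $F\times E'$ generated by $(1,1)$, $(0,\pi^a)$, $(0,\pi^bx+c)$. Then: (1) Every order of $E$ is of the form $\mathcal O_{a,b,c}$ with $a\le2\min(b,\mathrm{ord}(c))$. Conversely, an $\mathfrak o$-module $\mathcal O_{a,b,c}$ with $a\le 2\min(b,\mathrm{ord}(c))$ is an order. (2) An order $\mathcal O_{a',b',c'}$ contains an order $\mathcal O_{a,b,c}$ if and only if $a'\le a$, $b'\le b$, and $$\begin{cases}c'\in(\pi^{\max(\lceil a'/2\rceil,\,a'-(b-b'))}) & \text{if }\mathrm{ord}(c)\ge a';\\ c'-\pi^{-(b-b')}c\in(\pi^{a'-(b-b')}) & \text{if }\mathrm{ord}(c)<a'.\end{cases}$$ In the second case, $\lceil a'/2\rceil\le\mathrm{ord}(c)-(b-b')=\mathrm{ord}(c')$ (and thus $a'-(b-b')>0$). (3) Two orders $\mathcal O_{a',b',c'}$ and $\mathcal O_{a,b,c}$ are equal if and only if $a=a'$, $b=b'$ and $c-c'\in(\pi^a)$. (4) For an order $\mathcal O_{a,b,c}$, $S(\mathcal O_{a,b,c})=a+b$ and the conductor is $\mathfrak f(\mathcal O_{a,b,c})=(\pi^a)\times(\pi^{\max(a,\,b,\,a+b-\mathrm{ord}(c))})$ as an ideal of $\mathcal O_E=\mathfrak o\times\mathcal O_{E'}$. (5) An order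 $\mathcal O_{a,b,c}$ is Gorenstein if and only if $$\begin{cases}a=2b\text{ or }a=0 & \text{if }\mathrm{ord}(c)\ge a;\\ a=2\min(b,\mathrm{ord}(c)) & \text{if }\mathrm{ord}(c)<a.\end{cases}$$
   Context: $F$ has any characteristic, ring of integers $\mathfrak o$, uniformizer $\pi$; $\mathrm{ord}$ is the normalized valuation of $F$ with $\mathrm{ord}(0)=\infty$. For $j\in\mathbb Z$, $(\pi^j)=\pi^j\mathfrak o\subset F$ in (2) (conditions are read in $F$). $x\in\mathcal O_{E'}^\times$ is a fixed element with $\mathcal O_{E'}=\mathfrak o[x]$. The maximal order of $E$ is $\mathcal O_E=\mathfrak o\times\mathcal O_{E'}$. An order of $E$ is a subring $\mathcal O\subset E$ containing $\mathfrak o$ (diagonally), finitely generated as an $\mathfrak o$-module, with $F\mathcal O=E$. $S(\mathcal O)$ is the $\mathfrak o$-length of $\mathcal O_E/\mathcal O$; $\mathfrak f(\mathcal O)=\{a\in\mathcal O_E:a\mathcal O_E\subset\mathcal O\}$. A fractional $\mathcal O$-ideal is a finitely generated $\mathcal O$-submodule $I\subset E$ with $FI=E$; it is invertible if $IJ=\mathcal O$ for some fractional ideal $J$. $\mathcal O$ is Gorenstein if every fractional $\mathcal O$-ideal $I$ with $\{y\in E:yI\subset I\}=\mathcal O$ is invertible. *)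

(* Defs.v *)
From HB Require Import structures.
From mathcomp Require Import all_boot all_order all_algebra all_field.
From mathcomp Require Import boolp classical_sets constructive_ereal.

Set Implicit Arguments.
Unset Strict Implicit.
Unset Printing Implicit Defensive.
Import Order.TTheory GRing.Theory Num.Theory.

Local Open Scope classical_set_scope.
Local Open Scope ring_scope.

(* The value +oo encodes ord 0 = oo. *)
Record nonarch_local_field (F : fieldType) (ord : F -> \bar int) : Prop := {
  ord_eqoo : forall u, ord u = +oo%E <-> u = 0 ;
  ord_fin : forall u : F, u != 0 -> ord u \is a fin_num ;
  ordM : forall u v, ord (u * v) = (ord u + ord v)%E ;
  ordD : forall u v, (mine (ord u) (ord v) <= ord (u + v)%R)%E ;
  ord_normalized : exists u, ord u = 1%:E ;
  ord_complete : forall s : nat -> F,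
    (forall N : int, exists n0 : nat, forall m n : nat,
        (n0 <= m)%N -> (n0 <= n)%N -> (N%:E <= ord (s m - s n)%R)%E) ->
    exists l : F, forall N : int, exists n0 : nat, forall n : nat,
        (n0 <= n)%N -> (N%:E <= ord (s n - l)%R)%E ;
  residue_finite : exists r : seq F, forall u, (0%:E <= ord u)%E ->
    exists2 v, v \in r & (0%:E < ord (u - v)%R)%E }.

Definition uniformizer (F : fieldType) (ord : F -> \bar int) (pi : F) : Prop :=
  ord pi = 1%:E.

Definition intring (F : fieldType) (ord : F -> \bar int) : set F :=
  [set u | (0%:E <= ord u)%E].

Definition maxideal (F : fieldType) (ord : F -> \bar int) : set F :=
  [set u | (0%:E < ord u)%E].

(* The finite sums of products k *: g with k in A and g in G.  For A a subring
   this is the A-submodule generated by G; in the regular module R^o, for two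
   submodules I and J of R, [lspan I J] is the product I J. *)
Definition lspan (R : nzRingType) (V : lmodType R) (A : set R) (G : set V)
    : set V :=
  [set v | exists (n : nat) (k : 'I_n -> R) (g : 'I_n -> V),
     [/\ forall i, A (k i), forall i, G (g i) & v = \sum_(i < n) k i *: g i]].

Definition finitely_generated (R : nzRingType) (V : lmodType R) (A : set R)
    (M : set V) : Prop :=
  exists s : seq V, M = lspan A [set` s].

Definition is_submodule (R : nzRingType) (V : lmodType R) (A : set R)
    (M : set V) : Prop :=
  [/\ M 0, forall u v, M u -> M v -> M (u + v)
    & forall k u, A k -> M u -> M (k *: u)].

(* A chain of submodules of the quotient N / M, given by the preimages of its
   members in N. *)
Definition strict_chain (R : nzRingType) (V : lmodType R) (A : set R)
    (M N : set V) (n : nat) (C : nat -> set V) : Prop :=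
  (forall i, (i <= n)%N -> [/\ is_submodule A (C i), M `<=` C i & C i `<=` N])
  /\ (forall i, (i < n)%N -> C i `<` C i.+1).

(* n is the largest length of a strict chain of submodules of N / M. *)
Definition has_length (R : nzRingType) (V : lmodType R) (A : set R)
    (M N : set V) (n : nat) : Prop :=
  (exists C, strict_chain A M N n C) /\
  (forall m C, strict_chain A M N m C -> (m <= n)%N).

Section Extension.
Variables (F : fieldType) (ord : F -> \bar int) (L : fieldExtType F).

Definition intclosure : set L :=
  [set y | exists p : {poly F},
     [/\ p \is monic, forall i, intring ord p`_i
       & root (map_poly (in_alg L) p) y]].

Definition intclosure_unit : set L :=
  [set y | [/\ y != 0, intclosure y & intclosure y^-1]].

(* The maximal ideal of the integers of F generates the maximal ideal of the
   integers of L (its nonunits).  Separability of the residue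
   extension is automatic, the residue field of F being finite. *)
Definition unramified : Prop :=
  intclosure `\` intclosure_unit =
  lspan (V := L^o) intclosure [set t%:A | t in maxideal ord].

Definition adjoin (x : L) : set L :=
  [set (map_poly (in_alg L) p).[x] | p in
     [set p : {poly F} | forall i, intring ord p`_i]].

End Extension.

Arguments intclosure {F} ord L.

Section Orders.
Variables (F : fieldType) (ord : F -> \bar int) (E : comAlgType F).
Implicit Types O I J : set E.

Definition is_order O : Prop :=
  [/\ subring_closed (mem O),
      forall u, intring ord u -> O u%:A,
      finitely_generated (intring ord) O
    & lspan setT O = setT].

Definition fractional_ideal O I : Prop :=
  finitely_generated (V := E^o) O I /\ lspan setT I = setT.

Definition invertible O I : Prop :=
  exists2 J, fractional_ideal O J & lspan (V := E^o) I J = O.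

Definition multiplier I : set E := [set y | forall z, I z -> I (y * z)].

Definition gorenstein O : Prop :=
  forall I, fractional_ideal O I -> multiplier I = O -> invertible O I.

Definition conductor (Omax O : set E) : set E :=
  [set u | Omax u /\ forall z, Omax z -> O (u * z)].

End Orders.

Section QuadraticAlgebra.
Variables (F : fieldType) (ord : F -> \bar int) (pi : F) (L : fieldExtType F).

(* E = F x E'; the regular module F^o makes it an F-algebra. *)
Definition Ealg : comAlgType F := (F^o * L)%type.

Definition maxorder : set Ealg := intring ord `*` intclosure ord L.

Definition ppow (j : int) : set F := [set pi ^ j * z | z in intring ord].

Definition ppowL (j : int) : set L :=
  [set (pi ^ j) *: z | z in intclosure ord L].

Definition Oabc (x : L) (a b : nat) (c : F) : set Ealg :=
  lspan (V := Ealg) (intring ord)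
    [set (1, 1); (0, (pi ^+ a)%:A); (0, pi ^+ b *: x + c%:A)].

End QuadraticAlgebra.

Arguments maxorder {F} ord L.
Arguments ppowL {F} ord pi L j.

(* Main.v *)
Require Import Defs.
From mathcomp Require Import all_boot all_order all_algebra all_field.
From mathcomp Require Import boolp classical_sets constructive_ereal.
From mathcomp Require Import zify ring.
Set Implicit Arguments.
Unset Strict Implicit.
Unset Printing Implicit Defensive.
Import Order.TTheory GRing.Theory Num.Theory.
Local Open Scope classical_set_scope.
Local Open Scope ring_scope.

(* Write x^2 = T x - N. The integers of E' being o + o x, the unramifiedness hypothesis
   makes the norm form u^2 + T u v + N v^2 anisotropic modulo pi. In the coordinates of
   F x (F + F x), O_{a,b,c} is cut out by three valuation conditions, which turns (2), (3)
   and the conductor into computations; it is a ring iff pi^a divides the norm of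
   pi^b x + c, and every lattice between an O_{a,b,c} and the maximal order is of this form.

   For (5), let n = norm(pi^b x + c). If a = 0, then O is o times a quadratic order; if
   a > 0 and n / pi^a is a unit, then O = o[beta] with beta nilpotent modulo pi. In both
   cases an ideal I with multiplier ring O contains a g such that r g is outside pi I for
   all r in O outside pi O, and then I = g O. In the remaining case the dual lattice
   of O has multiplier ring O but is not invertible. *)

(** The valuation of the norm of u + v x is 2 min(ord u, ord v), hence even. This is the origin of
    the halves: pi^a divides n iff b and ord(c) are both at least ceil(a/2), and in an order n /
    pi^a is a unit iff a = 2 min(b, ord(c)).

    The difficulty in (5) is an exchange of quantifiers. That I has multiplier ring O says only that
    each r outside pi O admits some g in I, depending on r, with r g outside pi I. A single g works
    for all r when the socle of O / pi O is simple: every nonzero class has a multiple spanning the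
    socle, so it suffices to choose g for a generator of the socle. With k the residue field, a > 0
    and n / pi^a a unit, O / pi O is k[beta]/(beta^3) with socle spanned by beta^2; for a = 0 the
    idempotents allow the same argument in each factor. In the remaining case the maximal ideal of O
    / pi O has square zero and dimension 2, so the socle is not simple. *)

(** * Finite spans *)

Section Span.
Variables (R : nzRingType) (V : lmodType R).
Implicit Types (A : set R) (G M : set V).

Lemma lspan_sub A G M : M 0 -> (forall u v, M u -> M v -> M (u + v)) ->
  (forall k g, A k -> G g -> M (k *: g)) -> lspan A G `<=` M.
Proof.
move=> M0 MD Mk v [n [k [g [Ak Gg ->]]]].
by elim/big_ind: _ => // i _; apply: Mk.
Qed.

Lemma lspanZ A G k g : A k -> G g -> lspan A G (k *: g).
Proof.
by move=> Ak Gg; exists 1%N, (fun=> k), (fun=> g); rewrite big_ord1.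
Qed.

Lemma lspan0 A G : lspan A G 0.
Proof.
exists 0%N, (fun=> 0), (fun=> 0).
by split; rewrite ?big_ord0 // => -[].
Qed.

Lemma lspanD A G u v : lspan A G u -> lspan A G v -> lspan A G (u + v).
Proof.
move=> [n [k [g [Ak Gg ->]]]] [m [k' [g' [Ak' Gg' ->]]]].
pose glue T (f : 'I_n -> T) (f' : 'I_m -> T) i :=
  match split i with inl j => f j | inr j => f' j end.
exists (n + m)%N, (glue _ k k'), (glue _ g g').
split=> [i|i|]; try by rewrite /glue; case: (split i).
rewrite big_split_ord /glue; congr (_ + _); apply: eq_bigr => i _.
  by case: split_ordP => j /eqP; rewrite ?eq_lshift ?eq_lrshift // => /eqP ->.
by case: split_ordP => j /eqP; rewrite ?eq_rshift ?eq_rlshift // => /eqP ->.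
Qed.

End Span.

(** * The valuation *)

Section Valuation.
Variables (F : fieldType) (ord : F -> \bar int) (hF : nonarch_local_field ord).
Variables (pi : F) (hpi : uniformizer ord pi).
Implicit Types (u v : F) (j k : int).

(** A threshold test at an integer keeps +oo out of the computations, since zero passes every test.
    By contrast [val 0] is only the default value of [fine]. *)
Definition vge k u : bool := (k%:E <= ord u)%E.
Definition val u : int := fine (ord u).

Lemma intringE u : intring ord u = vge 0 u :> Prop.
Proof. by []. Qed.

Lemma ord_zero : ord 0 = +oo%E.
Proof. exact/(ord_eqoo hF). Qed.

Lemma ordE u : u != 0 -> ord u = (val u)%:E.
Proof. by move=> /(ord_fin hF) ?; rewrite /val fineK. Qed.

Lemma vgeE k u : vge k u = (u == 0) || (k <= val u).
Proof.
rewrite /vge; have [->|u0] := eqVneq; first by rewrite ord_zero leey.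
by rewrite ordE // lee_fin.
Qed.

Lemma vge0 k : vge k 0.
Proof. by rewrite vgeE eqxx. Qed.

Lemma valM u v : u != 0 -> v != 0 -> val (u * v) = val u + val v.
Proof.
move=> u0 v0; have uv0 : u * v != 0 by rewrite mulf_neq0.
by have := ordM hF u v; rewrite !ordE // -EFinD => -[].
Qed.

Lemma val1 : val 1 = 0.
Proof.
have one0 : (1 : F) != 0 by exact: oner_neq0.
by have := valM one0 one0; rewrite mulr1; lia.
Qed.

(** The square of [-1] is [1], so [-1] has valuation 0. *)
Lemma valN u : val (- u) = val u.
Proof.
have [->|u0] := eqVneq u 0; first by rewrite oppr0.
have m0 : (-1 : F) != 0 by rewrite oppr_eq0 oner_eq0.
have := valM m0 m0; rewrite mulrNN mulr1 val1 => h.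
by rewrite -mulN1r valM //; lia.
Qed.

Lemma pi_neq0 : pi != 0.
Proof. by apply/eqP => p0; move: hpi; rewrite /uniformizer p0 ord_zero. Qed.

Lemma val_pi : val pi = 1.
Proof. by rewrite /val hpi. Qed.

Lemma valV u : u != 0 -> val u^-1 = - val u.
Proof.
move=> u0; have ui0 : u^-1 != 0 by rewrite invr_eq0.
by have := valM u0 ui0; rewrite divff // val1; lia.
Qed.

Lemma piX_neq0 j : pi ^ j != 0.
Proof. by rewrite expfz_neq0 // pi_neq0. Qed.

Lemma val_piX j : val (pi ^ j) = j.
Proof.
have nat n : val (pi ^+ n) = n.
  elim: n => [|n IHn]; first by rewrite expr0 val1.
  by rewrite exprS valM ?expf_neq0 ?pi_neq0 // IHn val_pi; lia.
case: j => n; first exact: nat.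
by rewrite NegzE -exprnN valV ?expf_neq0 ?pi_neq0 // nat.
Qed.

Lemma vge_pi k j u : vge k (pi ^ j * u) = vge (k - j) u.
Proof.
rewrite !vgeE mulf_eq0 (negPf (piX_neq0 j)) /=.
have [//|u0] := eqVneq u 0.
by rewrite valM ?piX_neq0 // val_piX lerBlDl.
Qed.

Lemma vge_pin k n u : vge k (pi ^+ n * u) = vge (k - n%:Z) u.
Proof. exact: (vge_pi k n%:Z u). Qed.

Lemma vge_divn k n u : vge k (u / pi ^+ n) = vge (k + n%:Z) u.
Proof. by rewrite mulrC exprnN vge_pi opprK. Qed.

Lemma vge_le k j u : (k <= j)%R -> vge j u -> vge k u.
Proof. by rewrite !vgeE => kj /orP[->//|/(le_trans kj) ->]; rewrite orbT. Qed.

Lemma vgeN k u : vge k (- u) = vge k u.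
Proof. by rewrite !vgeE oppr_eq0 valN. Qed.

Lemma vgeD k u v : vge k u -> vge k v -> vge k (u + v).
Proof.
rewrite /vge => hu hv; apply: le_trans (ordD hF u v).
by rewrite /mine; case: ifP.
Qed.

Lemma vgeB k u v : vge k u -> vge k v -> vge k (u - v).
Proof. by move=> hu hv; rewrite vgeD // vgeN. Qed.

Lemma vgeM j k u v : vge j u -> vge k v -> vge (j + k) (u * v).
Proof.
rewrite !vgeE mulf_eq0.
have [//|u0] := eqVneq u 0; have [//|v0] := eqVneq v 0.
by rewrite /= valM //; lia.
Qed.

Lemma vge_piX j k : vge j (pi ^ k) = (j <= k)%R.
Proof. by rewrite vgeE (negPf (piX_neq0 k)) val_piX. Qed.

Lemma vge_piXn j n : vge j (pi ^+ n) = (j <= n)%R.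
Proof. exact: (vge_piX j n%:Z). Qed.

Lemma vge01 : vge 0 1.
Proof. by rewrite vgeE val1 lexx orbT. Qed.

Lemma vgeDl k u v : vge k v -> vge k (u + v) = vge k u.
Proof.
move=> kv; apply/idP/idP => [h|h]; last exact: vgeD.
by rewrite -(addrK v u) vgeB.
Qed.

Lemma vgeMr k u v : vge 0 v -> vge k u -> vge k (u * v).
Proof. by move=> hv hu; have := vgeM hu hv; rewrite addr0. Qed.

Lemma vgeMl k u v : vge 0 u -> vge k v -> vge k (u * v).
Proof. by move=> hu hv; have := vgeM hu hv; rewrite add0r. Qed.

Lemma vge_Xn n u : vge 0 u -> vge 0 (u ^+ n).
Proof.
move=> hu; elim: n => [|n IH]; first by rewrite expr0 vge01.
by rewrite exprS vgeMl.
Qed.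

(** The two hypotheses together say that [u] is a unit of the integers; units are expressed by this
    pair throughout. *)
Lemma vge_unit u v : vge 0 u -> ~~ vge 1 u -> forall k, vge k (u * v) = vge k v.
Proof.
rewrite !vgeE negb_or => h /andP[u0]; rewrite (negPf u0) /= in h * => h' k.
rewrite !vgeE mulf_eq0 (negPf u0) /=.
have [//|v0] := eqVneq v 0.
by rewrite valM //=; lia.
Qed.

(** A negative valuation would give [u ^+ B.+1] valuation at most [- B.+1], below the bound. *)
Lemma vge_exp_bounded (B : nat) u :
  (forall n : nat, vge (- B%:Z) (u ^+ n)) -> vge 0 u.
Proof.
move=> hB; rewrite vgeE; have [//|u0 /=] := eqVneq u 0.
have valX n : val (u ^+ n) = n%:Z * val u.
  elim: n => [|n IHn]; first by rewrite expr0 val1 mul0r.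
  by rewrite exprS valM ?expf_neq0 // IHn; lia.
have := hB B.+1; rewrite vgeE expf_eq0 (negPf u0) andbF /= valX; nia.
Qed.

Lemma vge_exists u : exists n : nat, vge (- n%:Z) u.
Proof. by exists `|val u|%N; rewrite vgeE; lia. Qed.

(** Lets a module over the integers trade a nonzero coordinate for a power of pi, so that minimality
    of an exponent bounds the valuation of [u]. *)
Lemma vge_assoc_pi u : u != 0 -> vge 0 u ->
  exists n : nat, exists2 e, vge 0 e & e * u = pi ^+ n /\ vge n u.
Proof.
move=> u0; rewrite vgeE (negPf u0) /= => hu.
exists `|val u|%N, (pi ^+ `|val u| / u); last first.
  by rewrite divfK // vgeE (negPf u0) /= gez0_abs.
rewrite vgeE valM ?invr_eq0 ?expf_neq0 ?pi_neq0 // valV //.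
by rewrite -[pi ^+ _]/(pi ^ (`|val u|%N : int)) val_piX; lia.
Qed.

Lemma vge_unbounded u : u != 0 -> exists n : nat, ~~ vge n u.
Proof.
by move=> u0; exists `|val u|.+1; rewrite vgeE negb_or u0 /=; lia.
Qed.

Lemma vge_maxideal u : maxideal ord u -> vge 1 u.
Proof.
by rewrite /maxideal /vge /=; case: (ord u) => //= r; rewrite !lte_fin !lee_fin; lia.
Qed.

Lemma ppowE j u : ppow ord pi j u <-> vge j u.
Proof.
split=> [[z hz <-]|h]; first by rewrite vge_pi subrr.
exists (pi ^ (- j) * u); last by rewrite mulrA -expfzDr ?pi_neq0 // subrr mul1r.
by change (is_true (vge 0 (pi ^ (- j) * u))); rewrite vge_pi sub0r opprK.
Qed.

(** Splitting the minimum removes the factor 2 and a possibly infinite [ord c]: each entry is at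
    least a / 2, rounded up because finite valuations are integers. *)
Lemma order_bound (a b : nat) c :
  (a%:Z%:E <= 2%:E * mine b%:Z%:E (ord c))%E <-> (uphalf a <= b)%N /\ vge (uphalf a) c.
Proof.
rewrite /vge; have [->|cn0] := eqVneq c 0.
  rewrite ord_zero miney -EFinM lee_fin leey.
  by split=> [h|[h _]]; first split=> //; lia.
rewrite (ordE cn0) -EFin_min -EFinM !lee_fin.
by split=> [h|[h1 h2]]; first split; lia.
Qed.

End Valuation.

(** * Coordinates and the norm form on the quadratic extension *)

Section Quadratic.
Variables (F : fieldType) (L : fieldExtType F) (hdim : \dim {:L} = 2%N).
Variables (x : L) (hxF : x \notin 1%VS).

Definition qbasis : 2.-tuple L := [tuple 1; x].
Definition c0 (z : L) : F := coord qbasis ord0 z.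
Definition c1 (z : L) : F := coord qbasis (lift ord0 ord0) z.

Lemma scal_gen_eq0 (u v : F) : u%:A + v *: x = 0 -> u = 0 /\ v = 0.
Proof.
have [->|v0] := eqVneq v 0.
  by rewrite scale0r addr0 => /eqP; rewrite scaler_eq0 oner_eq0 orbF => /eqP.
move=> h; case/negP: hxF; suff -> : x = (- (v^-1 * u))%:A by rewrite rpredZ ?mem1v.
apply: (scalerI v0); rewrite scalerA mulrN mulrA mulfV // mul1r scaleNr.
by apply/eqP; rewrite -addr_eq0 addrC h.
Qed.

Lemma qbasis_basis : basis_of {:L} qbasis.
Proof.
rewrite basisEfree subvf size_tuple hdim leqnn !andbT.
apply/freeP => k; rewrite big_ord_recl big_ord1 /= => /scal_gen_eq0[k0 k1] i.
by case: (unliftP ord0 i) => [j ->|->]; [rewrite (ord1 j)|].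
Qed.

Lemma c01E z : z = (c0 z)%:A + c1 z *: x.
Proof.
by rewrite {1}(coord_basis qbasis_basis (memvf z)) big_ord_recl big_ord1.
Qed.

Lemma c01_inj (u v u' v' : F) :
  u%:A + v *: x = u'%:A + v' *: x -> u = u' /\ v = v'.
Proof.
move=> /eqP; rewrite -subr_eq0 opprD addrACA -!scalerBl => /eqP/scal_gen_eq0.
by move=> [/eqP + /eqP]; rewrite !subr_eq0 => /eqP-> /eqP->.
Qed.

Lemma c0E u v : c0 (u%:A + v *: x) = u.
Proof. by have [] := c01_inj (esym (c01E (u%:A + v *: x))). Qed.

Lemma c1E u v : c1 (u%:A + v *: x) = v.
Proof. by have [] := c01_inj (esym (c01E (u%:A + v *: x))). Qed.

Lemma c0D y z : c0 (y + z) = c0 y + c0 z.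
Proof. exact: linearD. Qed.
Lemma c1D y z : c1 (y + z) = c1 y + c1 z.
Proof. exact: linearD. Qed.
Lemma c0N y : c0 (- y) = - c0 y.
Proof. exact: linearN. Qed.
Lemma c1N y : c1 (- y) = - c1 y.
Proof. exact: linearN. Qed.
Lemma c0Z k y : c0 (k *: y) = k * c0 y.
Proof. exact: linearZ. Qed.
Lemma c1Z k y : c1 (k *: y) = k * c1 y.
Proof. exact: linearZ. Qed.
Lemma c00 : c0 0 = 0.
Proof. exact: linear0. Qed.
Lemma c10 : c1 0 = 0.
Proof. exact: linear0. Qed.
Lemma c01 : c0 1 = 1.
Proof. by rewrite -[1 in LHS]scale1r -[1 *: 1]addr0 -(scale0r x) c0E. Qed.
Lemma c11 : c1 1 = 0.
Proof. by rewrite -[1 in LHS]scale1r -[1 *: 1]addr0 -(scale0r x) c1E. Qed.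
Lemma c0x : c0 x = 0.
Proof. by rewrite -[x]add0r -(scale0r 1) -[x in LHS]scale1r c0E. Qed.
Lemma c1x : c1 x = 1.
Proof. by rewrite -[x]add0r -(scale0r 1) -[x in LHS]scale1r c1E. Qed.

End Quadratic.

(** * Integral elements of the quadratic extension *)

Section Integers.
Variables (F : fieldType) (ord : F -> \bar int) (hF : nonarch_local_field ord).
Variables (pi : F) (hpi : uniformizer ord pi).
Variables (L : fieldExtType F) (hdim : \dim {:L} = 2%N).
Local Notation vge := (vge ord).

(** If t had negative valuation, dividing a monic integral equation of degree n by t^n would put 1
    in the maximal ideal. *)
Lemma intclosure_scal (t : F) : intclosure ord L t%:A -> vge 0 t.
Proof.
move=> [p [pmon pint proot]].
have {proot} pt0 : p.[t] = 0.
  apply: (fmorph_inj (in_alg L)); rewrite rmorph0 -horner_map.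
  exact/eqP.
have [->|t0] := eqVneq t 0; first exact: vge0.
apply: contraT => tN; have s1 : vge 1 t^-1.
  move: tN; rewrite !vgeE // invr_eq0 (negPf t0) /= valV //; lia.
have [n sz] : exists n, size p = n.+1.
  by exists (size p).-1; rewrite prednK // size_poly_gt0 monic_neq0.
have pn : p`_n = 1 by move/monicP: pmon; rewrite lead_coefE sz.
have : p.[t] * t^-1 ^+ n = 0 by rewrite pt0 mul0r.
rewrite horner_coef sz big_ord_recr /= pn mul1r mulrDl -exprMn divff // expr1n.
rewrite mulr_suml => /eqP; rewrite addrC addr_eq0 => /eqP one.
suff : vge 1 1 by rewrite vgeE // oner_eq0 val1.
rewrite one vgeN //; elim/big_ind: _ => [|u v|i _].
- exact: vge0.
- exact: vgeD.
rewrite -mulrA vgeMl //; first exact: pint.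
have nE : n = (i + (n - i.+1).+1)%N by case: i => i /=; lia.
rewrite [X in t^-1 ^+ X]nE exprD mulrA -exprMn divff // expr1n mul1r exprS vgeMr // vge_Xn //.
exact: (vge_le hF) s1.
Qed.

Lemma intclosure_quadratic (y : L) (t n : F) :
  vge 0 t -> vge 0 n -> y * y = t *: y - n%:A -> intclosure ord L y.
Proof.
move=> ht hn hy; exists (('X - t%:P) * 'X + n%:P); split.
- rewrite monicE lead_coefDl ?lead_coefMX ?lead_coefXsubC //.
  by rewrite size_mulX ?polyXsubC_eq0 // size_XsubC size_polyC; case: eqP.
- case=> [|[|[|i]]]; rewrite intringE coefD coefMX coefB coefX !coefC /=;
    rewrite ?add0r ?addr0 ?subr0 ?sub0r ?vgeN ?vge0 ?vge01 //.
rewrite /root rmorphD rmorphM rmorphB /= !map_polyX !map_polyC /= !hornerE.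
by rewrite mulrBl hy mulr_algl -addrA [- _ + _]addrC addrA subrK subrr.
Qed.

Lemma notin1_exists : exists y : L, y \notin 1%VS.
Proof.
have /subvPn[y _ yN] : ~~ ({:L} <= 1)%VS.
  by apply/negP => /dimvS; rewrite hdim dimv1.
by exists y.
Qed.

(** Multiplying y by p replaces the coefficients t and n of its quadratic equation by p t and p^2 n,
    so a high power of pi makes both integral. *)
Lemma scaled_integral (y : L) :
  y \notin 1%VS -> exists k : nat, intclosure ord L (pi ^+ k *: y).
Proof.
move=> yN; pose t := c1 y (y * y); pose n := - c0 y (y * y).
have yy : y * y = t *: y - n%:A by rewrite {1}(c01E hdim yN (y * y)) addrC scaleNr opprK.
have [k1 h1] := vge_exists hF t; have [k2 h2] := vge_exists hF n.
have pX k : vge (k : nat) (pi ^+ k) by rewrite vge_piXn.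
exists (k1 + k2)%N; set p := pi ^+ _.
apply: (@intclosure_quadratic _ (p * t) (p * p * n)).
- by have := vgeM hF (pX (k1 + k2)%N) h1; apply: (vge_le hF); lia.
- by have := vgeM hF (vgeM hF (pX (k1 + k2)%N) (pX (k1 + k2)%N)) h2; apply: (vge_le hF); lia.
rewrite -scalerAl -scalerAr yy !scalerBr !scalerA; congr (_ *: y - _ *: 1); ring.
Qed.

End Integers.

Section Generator.
Variables (F : fieldType) (ord : F -> \bar int) (hF : nonarch_local_field ord).
Variables (pi : F) (hpi : uniformizer ord pi).
Variables (L : fieldExtType F) (hdim : \dim {:L} = 2%N).
Variables (x : L) (hgen : intclosure ord L = adjoin ord x).
Local Notation vge := (vge ord).

Lemma intclosureD y z :
  intclosure ord L y -> intclosure ord L z -> intclosure ord L (y + z).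
Proof.
rewrite hgen => -[p hp <-] [q hq <-]; exists (p + q); last by rewrite rmorphD hornerD.
by move=> i; rewrite intringE coefD vgeD //; [exact: hp|exact: hq].
Qed.

Lemma intclosureM y z :
  intclosure ord L y -> intclosure ord L z -> intclosure ord L (y * z).
Proof.
rewrite hgen => -[p hp <-] [q hq <-]; exists (p * q); last by rewrite rmorphM hornerM.
move=> i; rewrite intringE coefM; elim/big_ind: _ => [|u v|j _].
- exact: (vge0 hF).
- exact: (vgeD hF).
by rewrite vgeMl //; [exact: hp|exact: hq].
Qed.

(** Were x in F, all integers of E' would lie in F; but an element outside F becomes integral after
    scaling by a power of pi. *)
Lemma gen_notin1 : x \notin 1%VS.
Proof.
apply/negP => /vlineP[t xt].
have [y yN] := notin1_exists hdim.
have [k] := scaled_integral hF hpi hdim yN.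
rewrite hgen => -[p _ py]; case/negP: yN.
have -> : y = (pi ^- k * p.[t])%:A.
  rewrite -scalerA; apply: (canRL (scalerK _)).
    by rewrite expf_neq0 // (pi_neq0 hF hpi).
  by rewrite -py xt -[t%:A]/(in_alg L t) horner_map.
by rewrite rpredZ ?mem1v.
Qed.
Let hxF := gen_notin1.

Definition trx : F := c1 x (x * x).
Definition nrx : F := - c0 x (x * x).

Lemma gen_sqr : x * x = trx *: x - nrx%:A.
Proof. by rewrite {1}(c01E hdim hxF (x * x)) addrC scaleNr opprK. Qed.

Lemma intclosure_gen : intclosure ord L x.
Proof.
rewrite hgen; exists 'X; last by rewrite map_polyX hornerX.
by move=> i; rewrite intringE coefX; case: eqP; rewrite ?vge0 ?vge01.
Qed.

(** The quadratic polynomial q of x divides any integral equation p of x: the remainder has degree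
    at most 1 and vanishes at x, which is outside F. Hence p also kills the other root of q. Trace
    and norm of x are then integral, as sum and product of two integral elements. *)
Lemma intclosure_conj : intclosure ord L (trx%:A - x).
Proof.
have [p [pmon pint px]] := intclosure_gen; exists p; split=> //.
have q_root y : y * y = trx *: y - nrx%:A ->
    root (map_poly (in_alg L) (('X - trx%:P) * 'X + nrx%:P)) y.
  move=> hy; rewrite /root rmorphD rmorphM rmorphB /= !map_polyX !map_polyC /= !hornerE.
  by rewrite mulrBl hy mulr_algl -addrA [- _ + _]addrC addrA subrK subrr.
set q := (_ + nrx%:P) in q_root.
have qs : size q = 3%N.
  by rewrite size_polyDl size_mulX ?polyXsubC_eq0 // size_XsubC // size_polyC; case: eqP.
have q0 : q != 0 by rewrite -size_poly_eq0 qs.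
have rs : (size (p %% q)%R <= 2)%N by have := ltn_modpN0 p q0; rewrite qs.
have rE : p %% q = (p %% q)`_1 *: 'X + ((p %% q)`_0)%:P.
  apply/polyP => -[|[|i]]; rewrite coefD coefZ coefX coefC /= ?mulr0 ?mulr1 ?addr0 ?add0r //.
  by rewrite nth_default // (leq_trans rs).
have pE y : y * y = trx *: y - nrx%:A ->
    (map_poly (in_alg L) p).[y] = ((p %% q)`_0)%:A + (p %% q)`_1 *: y.
  move=> /q_root/eqP qy; rewrite {1}(divp_eq p q) rmorphD rmorphM hornerD hornerM.
  rewrite qy mulr0 add0r {1}rE rmorphD /= linearZ /= map_polyX map_polyC /= !hornerE.
  by rewrite addrC /= mulr_algl.
have [r0 r1] : (p %% q)`_0 = 0 /\ (p %% q)`_1 = 0.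
  by apply: (scal_gen_eq0 hxF); rewrite -pE ?gen_sqr //; exact/eqP.
rewrite /root pE ?r0 ?r1 ?scale0r ?add0r //.
rewrite -[trx *: (_ - _)]mulr_algl; set t := trx%:A; set n := nrx%:A.
have -> : n = t * x - x * x by rewrite gen_sqr mulr_algl subKr.
ring.
Qed.

Lemma trx_int : vge 0 trx.
Proof.
suff: intclosure ord L trx%:A by exact: intclosure_scal.
rewrite -(subrK x trx%:A); apply: intclosureD; [exact: intclosure_conj|exact: intclosure_gen].
Qed.

Lemma conj_mul : x * (trx%:A - x) = nrx%:A.
Proof. by rewrite mulrBr gen_sqr mulr_algr opprB addrC subrK. Qed.

Lemma nrx_int : vge 0 nrx.
Proof.
suff: intclosure ord L nrx%:A by exact: intclosure_scal.
by rewrite -conj_mul; apply: intclosureM; [exact: intclosure_gen|exact: intclosure_conj].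
Qed.

(** As [trx] and [nrx] are integral, reducing powers of x by the quadratic equation introduces no
    denominators. *)
Lemma intclosureE : intclosure ord L = [set z | vge 0 (c0 x z) /\ vge 0 (c1 x z)].
Proof.
apply/seteqP; split=> z; last first.
  move=> [h0 h1]; rewrite hgen; exists ((c0 x z)%:P + c1 x z *: 'X).
    move=> i; rewrite intringE coefD coefC coefZ coefX.
    case: i => [|[|i]] /=; rewrite ?mulr0 ?mulr1 ?addr0 ?add0r //.
    exact: (vge0 hF).
  rewrite rmorphD /= linearZ /= map_polyX map_polyC /= !hornerE mulr_algl.
  by rewrite [RHS](c01E hdim hxF z).
rewrite hgen => -[p hp <-].
rewrite horner_poly; elim/big_ind: _ => [|y y' [h0 h1] [h0' h1']|i _].
- by rewrite /= c00 c10 vge0.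
- by rewrite /= c0D c1D !vgeD.
rewrite /= mulr_algl c0Z c1Z; have hpi' := hp i.
suff [h0 h1] : vge 0 (c0 x (x ^+ i)) /\ vge 0 (c1 x (x ^+ i)) by rewrite !vgeMl.
elim: {hpi'} (nat_of_ord i) => [|n [h0 h1]].
  by rewrite expr0 c01 // c11 // vge0 ?vge01.
have -> : x ^+ n.+1 = (- (c1 x (x ^+ n) * nrx))%:A
                     + (c0 x (x ^+ n) + c1 x (x ^+ n) * trx) *: x.
  rewrite exprS {1}(c01E hdim hxF (x ^+ n)) mulrDr -scalerAr mulr1 -scalerAr gen_sqr.
  by rewrite scalerBr !scalerA scalerDl scaleNr [RHS]addrC addrA.
by rewrite c0E // c1E // vgeN // vgeD ?vgeMl ?trx_int ?nrx_int.
Qed.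

(** Brings the right-hand side of [unramified] into coordinates. *)
Lemma lspan_maxideal z :
  lspan (V := L^o) (intclosure ord L) [set t%:A | t in maxideal ord] z ->
  vge 1 (c0 x z) /\ vge 1 (c1 x z).
Proof.
apply: (@lspan_sub L L^o _ _ [set z : L | vge 1 (c0 x z) /\ vge 1 (c1 x z)])
  => [|y y'|k g].
- by rewrite /= c00 c10 vge0.
- by move=> [? ?] [? ?]; rewrite /= c0D c1D !vgeD.
rewrite intclosureE => -[h0 h1] [t ht <-].
have t1 := vge_maxideal ht.
have -> : k *: (t%:A : L^o) = t *: k by rewrite -[LHS]/(k * t%:A) mulr_algr.
by rewrite /= c0Z c1Z !vgeMr.
Qed.

End Generator.

(** * Anisotropy of the norm form *)

Section NormForm.
Variables (F : fieldType) (ord : F -> \bar int) (hF : nonarch_local_field ord).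
Variables (pi : F) (hpi : uniformizer ord pi).
Variables (L : fieldExtType F) (hdim : \dim {:L} = 2%N) (hunr : unramified ord L).
Variables (x : L) (hgen : intclosure ord L = adjoin ord x).
Local Notation vge := (vge ord).
Local Notation trx := (trx x).
Local Notation nrx := (nrx x).
Let hxF := gen_notin1 hF hpi hdim hgen.
Let xx := gen_sqr hF hpi hdim hgen.

Definition normf (u v : F) : F := u * u + trx * u * v + nrx * v * v.

Lemma normf_conj u v :
  (u%:A + v *: x) * ((u + trx * v)%:A - v *: x) = (normf u v)%:A.
Proof.
rewrite -[v *: x]mulr_algl /normf !scalerDl -!scalerA.
rewrite -[u *: (u *: 1)]mulr_algl -[trx *: (_ *: _)]mulr_algl -[u *: (v *: 1)]mulr_algl.
rewrite -[nrx *: _]mulr_algl -[v *: (v *: 1)]mulr_algl -[trx *: (v *: 1)]mulr_algl.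
have -> : nrx%:A = trx%:A * x - x * x by rewrite xx mulr_algl subKr.
ring.
Qed.

(** If z = u + v x is not a unit, unramifiedness puts both coordinates in the maximal ideal. If z is
    a unit, its conjugate is the norm times z^-1, so the coordinates of the conjugate lie in the
    maximal ideal, and with them v and then u. *)
Lemma normf_anisotropic u v :
  vge 0 u -> vge 0 v -> vge 1 (normf u v) -> vge 1 u /\ vge 1 v.
Proof.
move=> hu hv hn; set z := u%:A + v *: x.
have iz : intclosure ord L z.
  by rewrite (intclosureE hF hpi hdim hgen) /= c0E // c1E.
have [uz|nuz] := EM (intclosure_unit ord z); last first.
  have : (intclosure ord L `\` intclosure_unit ord (L := L)) z by [].
  rewrite hunr => /(lspan_maxideal hF hpi hdim hgen).
  by rewrite c0E // c1E.
have [z0 _] := uz; rewrite (intclosureE hF hpi hdim hgen) => -[i0 i1].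
have zbE : (u + trx * v)%:A + (- v) *: x = normf u v *: z^-1.
  apply: (mulfI z0); rewrite scaleNr normf_conj -scalerAr divff //.
have h1 : vge 1 v.
  by rewrite -vgeN // -(c1E hdim hxF (u + trx * v) (- v)) zbE c1Z vgeMr.
split=> //; have : vge 1 (u + trx * v).
  by rewrite -(c0E hdim hxF (u + trx * v) (- v)) zbE c0Z vgeMr.
by rewrite vgeDl // vgeMl // (trx_int hF hpi hdim hgen).
Qed.

Lemma normfZ k u v : normf (k * u) (k * v) = k * k * normf u v.
Proof. rewrite /normf; ring. Qed.

Lemma vge_normf (k : int) u v : vge k u -> vge k v -> vge (k + k) (normf u v).
Proof.
move=> hu hv; have hT := trx_int hF hpi hdim hgen; have hN := nrx_int hF hpi hdim hgen.
by rewrite /normf !vgeD // vgeM // vgeMl.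
Qed.

(** The valuation of the norm is even, so the bound 2k - 1 is as good as 2k. The induction is on a
    deficit d with u and v in (pi^(k-d)); rescaling and anisotropy lower d by one. *)
Lemma normf_vge (k : int) u v :
  vge (k + k - 1) (normf u v) -> vge k u /\ vge k v.
Proof.
move=> hn.
have [d [hu hv]] : exists d : nat, vge (k - d%:Z) u /\ vge (k - d%:Z) v.
  have [m hu] := vge_exists hF u; have [m' hv] := vge_exists hF v.
  by exists (`|k| + m + m')%N; split; [move: hu|move: hv]; apply: (vge_le hF); lia.
elim: d hu hv => [|d IHd]; first by rewrite subr0.
rewrite (_ : k - d.+1%:Z = k - d%:Z - 1) ; last by lia.
set j := k - d%:Z - 1 => hu hv.
have [hu' hv'] : vge 1 (pi ^ (- j) * u) /\ vge 1 (pi ^ (- j) * v).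
  apply: normf_anisotropic; try by rewrite vge_pi // sub0r opprK.
  rewrite normfZ -expfzDr ?(pi_neq0 hF hpi) // vge_pi //.
  by move: hn; apply: (vge_le hF); rewrite /j; lia.
apply: IHd; [move: hu'|move: hv'];
 by rewrite vge_pi //; apply: (vge_le hF); rewrite /j; lia.
Qed.

End NormForm.

(** * Lattices and orders in coordinates *)

Section OrderCoordinates.
Variables (F : fieldType) (ord : F -> \bar int) (hF : nonarch_local_field ord).
Variables (pi : F) (hpi : uniformizer ord pi).
Variables (L : fieldExtType F) (hdim : \dim {:L} = 2%N) (hunr : unramified ord L).
Variables (x : L) (hgen : intclosure ord L = adjoin ord x).
Local Notation vge := (vge ord).
Local Notation trx := (trx x).
Local Notation nrx := (nrx x).
Local Notation E := (Ealg L).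
Let hxF := gen_notin1 hF hpi hdim hgen.
Let xx := gen_sqr hF hpi hdim hgen.
Let pi0 := pi_neq0 hF hpi.
Let v0 := vge0 hF.
Let v1 := vge01 hF.
Implicit Types (a b : nat) (c : F) (y z : E).

Lemma cM (s t : L) :
  s * t = (c0 x s * c0 x t - nrx * c1 x s * c1 x t)%:A +
    (c0 x s * c1 x t + c1 x s * c0 x t + trx * c1 x s * c1 x t) *: x.
Proof.
rewrite {1}(c01E hdim hxF s) {1}(c01E hdim hxF t).
move: (c0 x s) (c1 x s) (c0 x t) (c1 x t) => p q p' q'.
rewrite -[q *: x]mulr_algl -[q' *: x]mulr_algl -[(_ + _ + _) *: x]mulr_algl.
pose i : {rmorphism F -> L} := in_alg L; have iE k : k%:A = i k by [].
have iN : i nrx = i trx * x - x * x by rewrite -!iE xx mulr_algl subKr.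
rewrite !iE !rmorphD rmorphN !rmorphM iN; ring.
Qed.

Lemma c0M (s t : L) : c0 x (s * t) = c0 x s * c0 x t - nrx * c1 x s * c1 x t.
Proof. by rewrite cM c0E. Qed.

Lemma c1M (s t : L) :
  c1 x (s * t) = c0 x s * c1 x t + c1 x s * c0 x t + trx * c1 x s * c1 x t.
Proof. by rewrite cM c1E. Qed.

(* On O_{a,b,c}, wc is the coefficient of the generator (0, pi^b x + c), and
   defect is pi^a times the coefficient of (0, pi^a). *)
Definition wc b y : F := c1 x y.2 / pi ^+ b.
Definition defect b c y : F := c0 x y.2 - y.1 - wc b y * c.
Definition Oset a b c : set E :=
  [set y | [/\ vge 0 y.1, vge 0 (wc b y) & vge a (defect b c y)]].

Lemma c1wc b y : c1 x y.2 = pi ^+ b * wc b y.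
Proof. by rewrite /wc mulrC divfK // expf_neq0. Qed.

Lemma c0defect b c y : c0 x y.2 = defect b c y + wc b y * c + y.1.
Proof. by rewrite /defect; ring. Qed.

Lemma wcD b y z : wc b (y + z) = wc b y + wc b z.
Proof. by rewrite /wc /= c1D mulrDl. Qed.

Lemma wcZ b k y : wc b (k *: y) = k * wc b y.
Proof. by rewrite /wc /= c1Z mulrA. Qed.

Lemma defectD b c y z : defect b c (y + z) = defect b c y + defect b c z.
Proof. by rewrite /defect wcD /= c0D; ring. Qed.

Lemma defectZ b c k y : defect b c (k *: y) = k * defect b c y.
Proof. by rewrite /defect wcZ /= c0Z -[k *: y.1]/(k * y.1); ring. Qed.

Lemma wcM b y z :
  wc b (y * z) = c0 x y.2 * wc b z + wc b y * c0 x z.2 + trx * pi ^+ b * wc b y * wc b z.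
Proof.
by rewrite {1}/wc /= c1M !(c1wc b); field; rewrite expf_neq0.
Qed.

(** The last term is the obstruction to closure under products: the others lie in (pi^a) when y and
    z are in O_{a,b,c} and c is integral, and for y = z = (0, pi^b x + c) only the last one
    survives. *)
Lemma defectM b c y z :
  defect b c (y * z) = defect b c y * c0 x z.2 + y.1 * defect b c z
    - defect b c y * wc b z * c - wc b y * wc b z * normf x c (pi ^+ b).
Proof.
rewrite {1}/defect wcM /= c0M !(c1wc b) !(c0defect b c) /normf.
rewrite -[y.1 * z.1 : F^o]/((y.1 : F) * z.1); ring.
Qed.

Lemma intclosureP (s : L) : intclosure ord L s <-> vge 0 (c0 x s) /\ vge 0 (c1 x s).
Proof. by rewrite (intclosureE hF hpi hdim hgen). Qed.

Lemma maxorderP y :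
  maxorder ord L y <-> [/\ vge 0 y.1, vge 0 (c0 x y.2) & vge 0 (c1 x y.2)].
Proof.
split=> [[h1 /intclosureP[h2 h3]]|[h1 h2 h3]]; first by split.
by split=> //; apply/intclosureP.
Qed.

Definition elt (u p q : F) : E := (u, p%:A + q *: x).

Lemma eltE y : y = elt y.1 (c0 x y.2) (c1 x y.2).
Proof. by rewrite /elt -(c01E hdim hxF) -surjective_pairing. Qed.

Lemma elt_inj y z :
  y.1 = z.1 -> c0 x y.2 = c0 x z.2 -> c1 x y.2 = c1 x z.2 -> y = z.
Proof. by move=> e1 e2 e3; rewrite (eltE y) (eltE z) e1 e2 e3. Qed.

Lemma c0elt u p q : c0 x (elt u p q).2 = p.
Proof. by rewrite c0E. Qed.

Lemma c1elt u p q : c1 x (elt u p q).2 = q.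
Proof. by rewrite c1E. Qed.

Lemma OsetP a b c u p q :
  Oset a b c (elt u p q) <-> [/\ vge 0 u, vge b q & vge a (p - u - q / pi ^+ b * c)].
Proof. by rewrite /Oset /= /defect /wc c0elt c1elt vge_divn // add0r. Qed.

Lemma Oset_submodule a b c : is_submodule (V := E) (intring ord) (Oset a b c).
Proof.
split=> [|y z [y1 y2 y3] [z1 z2 z3]|k y hk [y1 y2 y3]].
- by split; rewrite /defect /wc /= ?c00 ?c10 ?mul0r ?subr0 ?mul0r ?subr0 v0.
- by split; rewrite ?wcD ?defectD /= vgeD.
- by split; rewrite ?wcZ ?defectZ /= vgeMl.
Qed.

Lemma OabcE a b c : Oabc ord pi x a b c = Oset a b c.
Proof.
have [M0 MD MZ] := Oset_submodule a b c.
apply/seteqP; split.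
  apply: lspan_sub => // k g hk hg; apply: MZ => //.
  case: hg => [[]|] ->; rewrite /Oset /= /defect /wc /=.
  - by rewrite c01 // c11 // mul0r mul0r subrr subr0 !(v0, v1).
  - rewrite c0Z c1Z c01 // c11 // mulr0 mulr1 !mul0r !subr0 !v0.
    by rewrite vge_piXn.
  rewrite c0D c1D !c0Z !c1Z c01 // c11 // c0x // c1x // !mulr0 !mulr1 add0r addr0.
  by rewrite divff ?expf_neq0 // mul1r subr0 subrr !(v0, v1).
move=> y [h1 h2 h3].
have -> : y = y.1 *: ((1, 1) : E) + (defect b c y / pi ^+ a) *: ((0, (pi ^+ a)%:A) : E)
    + wc b y *: ((0, pi ^+ b *: x + c%:A) : E).
  apply: elt_inj; rewrite /= ?(c0D, c1D, c0Z, c1Z) ?c0x ?c1x ?c01 ?c11 //.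
  - by rewrite -![_ *: (_ : F^o)]/(_ * _ : F) mulr1 !mulr0 !addr0.
  - by rewrite /defect; field; rewrite expf_neq0.
  - by rewrite /wc; field; rewrite !expf_neq0.
apply: lspanD; first apply: lspanD.
- by apply: lspanZ => //; left; left.
- by apply: lspanZ; [rewrite intringE vge_divn|left; right].
- by apply: lspanZ => //; right.
Qed.

(** Both modules contain 1, so inclusion is tested on (0, pi^a) and (0, pi^b x + c); the last
    condition bounds the defect of the latter. *)
Lemma Oset_subset a b c a' b' c' :
  Oset a b c `<=` Oset a' b' c' <->
  [/\ (a' <= a)%N, (b' <= b)%N & vge a' (c - pi ^+ b / pi ^+ b' * c')].
Proof.
split=> [sub|[ha hb hc] y [h1 h2 h3]].
  have /OsetP[_ _] : Oset a' b' c' (elt 0 (pi ^+ a) 0).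
    by apply/sub/OsetP; rewrite !mul0r !subr0 !v0 vge_piXn.
  rewrite !mul0r !subr0 vge_piXn // => ha.
  have /OsetP[_ hb] : Oset a' b' c' (elt 0 c (pi ^+ b)).
    by apply/sub/OsetP; rewrite divff ?expf_neq0 // mul1r !subr0 subrr !v0 vge_piXn.
  by rewrite subr0; split=> //; rewrite vge_piXn in hb.
have wE : wc b' y = wc b y * (pi ^+ b / pi ^+ b').
  by rewrite /wc; field; rewrite !expf_neq0.
split=> //.
  by rewrite wE vgeMr // vge_divn // vge_piXn //; lia.
rewrite (_ : defect b' c' y = defect b c y + wc b y * (c - pi ^+ b / pi ^+ b' * c')).
  apply: (vgeD hF); last exact: (vgeMl hF).
  by move: h3; apply: (vge_le hF); lia.
by rewrite /defect wE; ring.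
Qed.

Lemma Oset_eq a b c a' b' c' :
  Oset a' b' c' = Oset a b c <-> [/\ a = a', b = b' & vge a (c - c')].
Proof.
split=> [e|[<- <- hc]].
  have /Oset_subset[ha hb hc] : Oset a' b' c' `<=` Oset a b c by rewrite e.
  have /Oset_subset[ha' hb' _] : Oset a b c `<=` Oset a' b' c' by rewrite e.
  have ea : a = a' by lia.
  have eb : b = b' by lia.
  split=> //; rewrite eb divff ?expf_neq0 // mul1r in hc.
  by rewrite -vgeN // opprB.
have pb : pi ^+ b / pi ^+ b = 1 by rewrite divff // expf_neq0.
apply/seteqP; split; apply/Oset_subset; rewrite pb mul1r; split=> //.
by rewrite -vgeN // opprB.
Qed.

Lemma submoduleN (M : set E) y : is_submodule (V := E) (intring ord) M -> M y -> M (- y).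
Proof.
move=> [_ _ MZ] My; rewrite -scaleN1r; apply: MZ => //.
by rewrite intringE vgeN.
Qed.

Lemma submoduleB (M : set E) y z :
  is_submodule (V := E) (intring ord) M -> M y -> M z -> M (y - z).
Proof. by move=> MM My Mz; have [_ MD _] := MM; apply: MD => //; apply: submoduleN. Qed.

Lemma Oset_decomp a b c y :
  y = y.1 *: (1 : E) + (defect b c y / pi ^+ a) *: elt 0 (pi ^+ a) 0
    + wc b y *: elt 0 c (pi ^+ b).
Proof.
apply: elt_inj; rewrite /= ?(c0D, c1D, c0Z, c1Z) ?c0x ?c1x ?c01 ?c11 //.
- by rewrite -![_ *: (_ : F^o)]/(_ * _ : F) mulr1 !mulr0 !addr0.
- by rewrite /defect; field; rewrite expf_neq0.
- by rewrite /wc; field; rewrite !expf_neq0.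
Qed.

(** * Normal form of lattices and classification of orders *)

(** A Hermite normal form: a is the least exponent with (0, pi^a) in O, and b the least n such that
    pi^n is the x-coordinate of an element of O with first component 0. It serves both for orders
    and for the members of a chain in the length computation. *)
Lemma lattice_Oset (O : set E) :
  is_submodule (V := E) (intring ord) O -> O 1 -> O `<=` maxorder ord L ->
  (exists k : nat, O (elt 0 (pi ^+ k) 0)) ->
  (exists k : nat, exists p, O (elt 0 p (pi ^+ k))) ->
  exists a b c, vge 0 c /\ O = Oset a b c.
Proof.
move=> OM O1 Omax [k hk] [l hl]; have [_ OD OZ] := OM.
have exa : exists n, `[< O (elt 0 (pi ^+ n) 0) >] by exists k; apply/asboolP.
have exb : exists n, `[< exists p, O (elt 0 p (pi ^+ n)) >] by exists l; apply/asboolP.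
case: (ex_minnP exa) => a /asboolP Oa mina; case: (ex_minnP exb) => b /asboolP[c Ob] minb.
have hc : vge 0 c by have [_ + _] := (maxorderP _).1 (Omax _ Ob); rewrite c0elt.
exists a, b, c; split=> //; apply/seteqP; split=> y; last first.
  move=> [h1 h2 h3]; rewrite (Oset_decomp a b c y); apply: (OD); first apply: (OD).
  - exact: OZ.
  - by apply: (OZ) => //; rewrite intringE vge_divn.
  - exact: OZ.
move=> Oy; have [y1 _ yq] := (maxorderP _).1 (Omax _ Oy).
have hb : vge 0 (wc b y).
  rewrite /wc vge_divn // add0r.
  have [->|q0] := eqVneq (c1 x y.2) 0; first exact: v0.
  have [n [e he [en vn]]] := vge_assoc_pi hF hpi q0 yq.
  apply: (vge_le hF _ vn); rewrite lez_nat; apply: minb; apply/asboolP.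
  exists (e * (c0 x y.2 - y.1)).
  have -> : elt 0 (e * (c0 x y.2 - y.1)) (pi ^+ n) = e *: (y - y.1 *: (1 : E)).
    apply: elt_inj; rewrite /= ?(c0D, c1D, c0N, c1N, c0Z, c1Z) ?c0x ?c1x ?c01 ?c11 //.
    - by rewrite -![_ *: (_ : F^o)]/(_ * _ : F) mulr1 subrr mulr0.
    - by ring.
    - by rewrite -en; ring.
  by apply: (OZ) => //; apply: submoduleB => //; exact: OZ.
split=> //.
have [->|d0] := eqVneq (defect b c y) 0; first exact: v0.
(* Subtracting from y its multiples of 1 and of (0, pi^b x + c) leaves an element to which the
   minimality of a applies. *)
have Od : O (elt 0 (defect b c y) 0).
  have -> : elt 0 (defect b c y) 0 = y - y.1 *: (1 : E) - wc b y *: elt 0 c (pi ^+ b).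
    apply: elt_inj; rewrite /= ?(c0D, c1D, c0N, c1N, c0Z, c1Z) ?c0x ?c1x ?c01 ?c11 //.
    - by rewrite -![_ *: (_ : F^o)]/(_ * _ : F) mulr1 subrr mulr0 subr0.
    - by rewrite /defect; ring.
    - by rewrite /wc; field; rewrite !expf_neq0.
  by apply: submoduleB => //; [apply: submoduleB|] => //; exact: OZ.
have vd : vge 0 (defect b c y).
  by have [_ + _] := (maxorderP _).1 (Omax _ Od); rewrite c0elt.
have [n [e he [en vn]]] := vge_assoc_pi hF hpi d0 vd.
apply: (vge_le hF _ vn); rewrite lez_nat; apply: mina; apply/asboolP.
have -> : elt 0 (pi ^+ n) 0 = e *: elt 0 (defect b c y) 0.
  apply: elt_inj; rewrite /= ?(c0D, c1D, c0N, c1N, c0Z, c1Z) ?c0x ?c1x ?c01 ?c11 //.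
  - by rewrite -![_ *: (_ : F^o)]/(_ * _ : F) mulr0.
  - by rewrite -en; ring.
  - by ring.
exact: OZ.
Qed.

Lemma subring_closedP (O : set E) :
  subring_closed (mem O) <->
  [/\ O 1, forall y z, O y -> O z -> O (y - z) & forall y z, O y -> O z -> O (y * z)].
Proof.
split=> [[h1 h2 h3]|[h1 h2 h3]].
  split=> [|y z Oy Oz|y z Oy Oz]; apply/set_mem; first exact: h1.
    by apply: h2; apply/mem_set.
  by apply: h3; apply/mem_set.
split=> [|y z Oy Oz|y z Oy Oz]; first by apply/mem_set.
  by apply/mem_set; apply: h2; apply/set_mem.
by apply/mem_set; apply: h3; apply/set_mem.
Qed.

Lemma Oset1 a b c : Oset a b c 1.
Proof.
by rewrite /Oset /= /defect /wc /= c01 // c11 // mul0r mul0r subrr subr0 !(v0, v1).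
Qed.

Lemma Oset_int a b c y : vge 0 c -> Oset a b c y ->
  [/\ vge 0 y.1, vge 0 (c0 x y.2) & vge b (c1 x y.2)].
Proof.
move=> hc [h1 h2 h3]; split=> //; last by rewrite (c1wc b) vge_pin // subrr.
rewrite (c0defect b c); apply: (vgeD hF) => //; apply: (vgeD hF); last exact: (vgeMl hF).
by apply: (vge_le hF _ h3); lia.
Qed.

Lemma Oset_max a b c : vge 0 c -> Oset a b c `<=` maxorder ord L.
Proof.
move=> hc y /(Oset_int hc)[h1 h2 h3]; apply/maxorderP; split=> //.
by apply: (vge_le hF _ h3); lia.
Qed.

Lemma Oset_absorbs a b c y : exists k : nat, Oset a b c (pi ^+ k *: y).
Proof.
have [k1 h1] := vge_exists hF y.1; have [k2 h2] := vge_exists hF (wc b y).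
have [k3 h3] := vge_exists hF (defect b c y).
exists (k1 + k2 + k3 + a)%N; rewrite /Oset /= wcZ defectZ.
by rewrite -![_ *: (_ : F^o)]/(_ * _ : F) !vge_pin //; split;
  [move: h1|move: h2|move: h3]; apply: (vge_le hF); lia.
Qed.

(** Coefficients in F have powers of pi as denominators, so F M = E amounts to clearing
    denominators. *)
Lemma lspan_full (M : set E) : is_submodule (V := E) (intring ord) M ->
  lspan setT M = setT <-> forall y, exists k : nat, M (pi ^+ k *: y).
Proof.
move=> [M0 MD MZ]; split=> [hM y|hM]; last first.
  apply/seteqP; split=> // y _; have [k hk] := hM y.
  have -> : y = (pi ^- k) *: (pi ^+ k *: y).
    by rewrite scalerA mulVf ?scale1r // expf_neq0.
  exact: lspanZ.
have : lspan setT M y by rewrite hM.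
move: y {hM}; apply: lspan_sub => [|y z [k hk] [l hl]|t g _ Mg].
- by exists 0%N; rewrite scaler0.
- exists (k + l)%N; rewrite scalerDr {2}addnC !exprD -!scalerA; apply: (MD).
    by rewrite scalerA mulrC -scalerA; apply: (MZ); rewrite ?intringE ?vge_piXn.
  by rewrite scalerA mulrC -scalerA; apply: (MZ); rewrite ?intringE ?vge_piXn.
have [k hk] := vge_exists hF t; exists k; rewrite scalerA; apply: (MZ) => //.
by rewrite intringE vge_pin // sub0r.
Qed.

Lemma Oset_mul a b c : (uphalf a <= b)%N -> vge (uphalf a) c ->
  forall y z, Oset a b c y -> Oset a b c z -> Oset a b c (y * z).
Proof.
move=> hab hc y z Oy Oz.
have c_int : vge 0 c by apply: (vge_le hF _ hc); lia.
have [y1 y0 _] := Oset_int c_int Oy; have [z1 z0 _] := Oset_int c_int Oz.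
have [_ yw yd] := Oy; have [_ zw zd] := Oz.
have hp (n : nat) : vge 0 (pi ^+ n) by rewrite vge_piXn.
have hT := trx_int hF hpi hdim hgen.
split=> /=; first exact: (vgeMl hF).
  rewrite wcM; apply: (vgeD hF); last by do 2![apply: (vgeMl hF) => //]; exact: (vgeMl hF).
  by apply: (vgeD hF); apply: (vgeMl hF).
rewrite defectM; apply: (vgeB hF); last first.
  apply: (vgeMl hF); first exact: (vgeMl hF).
  have hpb : vge (uphalf a)%:Z (pi ^+ b) by rewrite vge_piXn.
  have hle : a%:Z <= (uphalf a)%:Z + (uphalf a)%:Z by clear; lia.
  have hn := vge_normf hF hpi hdim hgen hc hpb.
  exact: (vge_le hF hle hn).
apply: (vgeB hF); last by do 2![apply: (vgeMr hF) => //].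
by apply: (vgeD hF); [apply: (vgeMr hF)|apply: (vgeMl hF)].
Qed.

Lemma Oset_is_order a b c : vge 0 c ->
  is_order ord (Oset a b c) <-> (uphalf a <= b)%N /\ vge (uphalf a) c.
Proof.
move=> c_int; have OM := Oset_submodule a b c; split=> [|[hab hc]].
  move=> [/subring_closedP[_ _ OMul] _ _ _].
  have hbeta : Oset a b c (elt 0 c (pi ^+ b)).
    by apply/OsetP; rewrite divff ?expf_neq0 // mul1r subr0 subrr !v0 vge_piXn.
  (* The defect of the square of (0, pi^b x + c) is minus the norm, which is therefore in (pi^a). As
     a >= 2 ceil(a/2) - 1, evenness gives both bounds. *)
  have [_ _] := OMul _ _ hbeta hbeta.
  rewrite defectM /defect c0elt /= /wc c1elt divff ?expf_neq0 // mul1r subr0 subrr.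
  rewrite !mul0r !subr0 addr0 mulr1 sub0r mul1r vgeN // => hn.
  have [] := @normf_vge _ _ hF _ hpi _ hdim hunr _ hgen (uphalf a) c (pi ^+ b).
    by apply: (vge_le hF _ hn); lia.
  by rewrite vge_piXn // => h1 h2; split=> //; lia.
split.
- apply/subring_closedP; split; [exact: Oset1| |exact: Oset_mul].
  by move=> y z; exact: submoduleB.
- move=> u hu; have [_ _ MZ] := OM; apply: (MZ) => //; exact: Oset1.
- rewrite -OabcE /Oabc.
  exists [:: (1, 1); (0, (pi ^+ a)%:A); (0, pi ^+ b *: x + c%:A)].
  congr (lspan _ _); apply/seteqP; split=> y /=.
    by rewrite !inE => -[[->|->]|->]; rewrite eqxx ?orbT.
  by rewrite !inE => /or3P[]/eqP->; [left; left|left; right|right].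
- by apply/(lspan_full OM) => y; exact: Oset_absorbs.
Qed.

Lemma normfM (s t : L) :
  normf x (c0 x (s * t)) (c1 x (s * t)) =
  normf x (c0 x s) (c1 x s) * normf x (c0 x t) (c1 x t).
Proof. by rewrite c0M c1M /normf; ring. Qed.

Lemma exp1E y n : (y ^+ n).1 = (y.1 : F) ^+ n.
Proof. by elim: n => // n IHn; rewrite !exprS /= IHn. Qed.

Lemma exp2E y n : (y ^+ n).2 = y.2 ^+ n.
Proof. by elim: n => // n IHn; rewrite !exprS /= IHn. Qed.

Lemma fg_bounded (O : set E) : finitely_generated (V := E) (intring ord) O ->
  exists B : nat, forall y, O y ->
  [/\ vge (- B%:Z) y.1, vge (- B%:Z) (c0 x y.2) & vge (- B%:Z) (c1 x y.2)].
Proof.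
move=> [s ->].
have [B hB] : exists B : nat, forall y, y \in s ->
    [/\ vge (- B%:Z) y.1, vge (- B%:Z) (c0 x y.2) & vge (- B%:Z) (c1 x y.2)].
  elim: s => [|g s [B hB]]; first by exists 0%N.
  have [k1 h1] := vge_exists hF g.1; have [k2 h2] := vge_exists hF (c0 x g.2).
  have [k3 h3] := vge_exists hF (c1 x g.2).
  exists (B + k1 + k2 + k3)%N => y; rewrite inE => /predU1P[->|/hB[b1 b2 b3]].
    by split; [move: h1|move: h2|move: h3]; apply: (vge_le hF); clear; lia.
  by split; [move: b1|move: b2|move: b3]; apply: (vge_le hF); clear; lia.
exists B; apply: lspan_sub => [|y z [h1 h2 h3] [h1' h2' h3']|k g hk /hB[h1 h2 h3]].
- by rewrite /= c00 c10 v0.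
- by rewrite /= c0D c1D !(vgeD hF).
- by rewrite /= c0Z c1Z !(vgeMl hF).
Qed.

Lemma order_submodule (O : set E) :
  is_order ord O -> is_submodule (V := E) (intring ord) O.
Proof.
move=> [/subring_closedP[O1 OB OM] Oscal _ _].
have O0 : O 0 by rewrite -(subrr 1); exact: OB.
split=> // [y z Oy Oz|k y hk Oy]; last by rewrite -mulr_algl; apply: OM => //; exact: Oscal.
by rewrite -[z]opprK; apply: (OB) => //; rewrite -[- z]sub0r; exact: OB.
Qed.

(* The powers of an element of O are bounded, which forces its first component and
   the norm of its second one to be integral; the coordinates follow by anisotropy. *)
Lemma order_max (O : set E) : is_order ord O -> O `<=` maxorder ord L.
Proof.
move=> [/subring_closedP[O1 _ OM] _ /fg_bounded[B hB] _] y Oy.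
have OX n : O (y ^+ n) by elim: n => // n IHn; rewrite exprS; exact: OM.
apply/maxorderP.
have y1 : vge 0 y.1.
  by apply: (vge_exp_bounded hF (B := B)) => n; rewrite -exp1E; have [] := hB _ (OX n).
have : vge 0 (normf x (c0 x y.2) (c1 x y.2)).
  apply: (vge_exp_bounded hF (B := (B + B)%N)) => n.
  have -> : normf x (c0 x y.2) (c1 x y.2) ^+ n
          = normf x (c0 x (y.2 ^+ n)) (c1 x (y.2 ^+ n)).
    elim: n => [|n IHn]; first by rewrite !expr0 c01 // c11 // /normf; ring.
    by rewrite !exprS normfM IHn.
  have [_ h2 h3] := hB _ (OX n); rewrite exp2E in h2 h3.
  by apply: (vge_le hF _ (vge_normf hF hpi hdim hgen h2 h3)); lia.
move=> hn; have [] // := @normf_vge _ _ hF _ hpi _ hdim hunr _ hgen 0 (c0 x y.2) (c1 x y.2).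
by apply: (vge_le hF _ hn).
Qed.

Lemma order_Oset (O : set E) : is_order ord O ->
  exists a b c, vge 0 c /\ O = Oset a b c.
Proof.
move=> Oord; have OM := order_submodule Oord.
have [/subring_closedP[O1 _ _] _ _ /(lspan_full OM) full] := Oord.
apply: lattice_Oset => //; first exact: order_max.
  have [k hk] := full (elt 0 1 0); exists k.
  suff -> : elt 0 (pi ^+ k) 0 = pi ^+ k *: elt 0 1 0 by [].
  apply: elt_inj; rewrite /= ?c0Z ?c1Z ?c0E ?c1E ?mulr1 ?mulr0 //.
  by rewrite -![_ *: (_ : F^o)]/(_ * _ : F) mulr0.
have [k hk] := full (elt 0 0 1); exists k, 0.
suff -> : elt 0 0 (pi ^+ k) = pi ^+ k *: elt 0 0 1 by [].
apply: elt_inj; rewrite /= ?c0Z ?c1Z ?c0E ?c1E ?mulr1 ?mulr0 //.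
by rewrite -![_ *: (_ : F^o)]/(_ * _ : F) mulr0.
Qed.

(** * Length and conductor *)

(** Every module between O and the maximal order is again some O_{a',b',c'}, and a' + b' drops at
    each strict inclusion because equal exponents force equality. This bounds all chains by a +
    b. *)
Lemma Oset_length a b c : vge 0 c ->
  has_length (V := E) (intring ord) (Oset a b c) (maxorder ord L) (a + b).
Proof.
move=> hc.
have hpn (k l : nat) : (l <= k)%N -> vge 0 (pi ^+ k / pi ^+ l).
  by move=> lk; rewrite vge_divn // vge_piXn //; lia.
split.
  (* Truncated subtraction lowers a to 0 during the first a steps, and only then b. *)
  exists (fun i => Oset (a - i) (b - (i - a)) c); split=> i hi.
    split; [exact: Oset_submodule| |exact: Oset_max].
    apply/Oset_subset; split; try lia.
    case: (leqP i a) => ia.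
      have -> : (b - (i - a) = b)%N by lia.
      by rewrite divff ?expf_neq0 // mul1r subrr v0.
    have -> : ((a - i)%N%:Z = 0)%R by lia.
    by rewrite (vgeB hF) // (vgeMl hF) // hpn //; lia.
  split; last by move/Oset_subset => [? ? _]; lia.
  apply/Oset_subset; split; try lia.
  case: (leqP i.+1 a) => ia.
    have -> : (b - (i.+1 - a) = b)%N by lia.
    have -> : (b - (i - a) = b)%N by lia.
    by rewrite divff ?expf_neq0 // mul1r subrr v0.
  have -> : ((a - i.+1)%N%:Z = 0)%R by lia.
  by rewrite (vgeB hF) // (vgeMl hF) // hpn //; lia.
move=> m C [Csub Cstrict].
have CO i : (i <= m)%N -> exists a' b' c', vge 0 c' /\ C i = Oset a' b' c'.
  move=> /Csub[CM CO Cmax]; apply: lattice_Oset => //.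
  - by apply: CO; exact: Oset1.
  - by exists a; apply/CO/OsetP; rewrite !mul0r !subr0 !v0 vge_piXn.
  - exists b, c; apply/CO/OsetP.
    by rewrite divff ?expf_neq0 // mul1r subr0 subrr !v0 vge_piXn.
suff : exists a' b' c', [/\ vge 0 c', C m = Oset a' b' c' & (a' + b' + m <= a + b)%N].
  by move=> [a' [b' [c' [_ _]]]]; lia.
suff H i : (i <= m)%N ->
  exists a' b' c', [/\ vge 0 c', C i = Oset a' b' c' & (a' + b' + i <= a + b)%N] by exact: H.
elim: i => [|i IHi] im.
  have [a' [b' [c' [hc' Ci]]]] := CO 0%N im; exists a', b', c'; split=> //.
  have [_ + _] := Csub 0%N im; rewrite Ci => /Oset_subset[? ? _]; lia.
have [a' [b' [c' [hc' Ci hi]]]] := IHi (ltnW im).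
have [a2 [b2 [c2 [hc2 Ci2]]]] := CO i.+1 im; exists a2, b2, c2; split=> //.
have [] := Cstrict i im; rewrite Ci Ci2 => sub nsub.
have /Oset_subset[ha hb hcc] := sub.
suff : (a2 + b2 != a' + b')%N by move: ha hb hi; clear; lia.
apply/eqP => e; have ea : a2 = a' by move: e ha hb; clear; lia.
have eb : b2 = b' by move: e ha hb; clear; lia.
apply: nsub; suff -> : Oset a2 b2 c2 = Oset a' b' c' by [].
apply/Oset_eq; split=> //; move: hcc.
by rewrite ea eb divff ?expf_neq0 // mul1r.
Qed.

Lemma ppowLP (j : int) (s : L) :
  ppowL ord pi L j s <-> vge j (c0 x s) /\ vge j (c1 x s).
Proof.
split=> [[z /intclosureP[h0 h1] <-]|[h0 h1]].
  by rewrite c0Z c1Z !vge_pi // subrr.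
exists (pi ^ (- j) *: s).
  by apply/intclosureP; rewrite c0Z c1Z !vge_pi // !opprK !add0r.
by rewrite scalerA -expfzDr // subrr scale1r.
Qed.

(** For c = 0 the entry a + b - ord(c) is -oo and drops out of the maximum, in accordance with u c =
    0. *)
Lemma vge_conductor_exponent a b c u : vge 0 c ->
  vge (fine (maxe (maxe a%:Z%:E b%:Z%:E) (a%:Z%:E + b%:Z%:E - ord c))%E) u <->
  [/\ vge a u, vge b u & vge (a%:Z + b%:Z) (u * c)].
Proof.
move=> hc; have [->|u0] := eqVneq u 0; first by rewrite mul0r !v0.
have [->|cn0] := eqVneq c 0.
  rewrite mulr0 (ord_zero hF) v0 addeNy ?maxeNy.
  rewrite -EFin_max /= !(vgeE hF) (negPf u0) /= ge_max.
  by split=> [/andP[-> ->]|[-> -> _]].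
rewrite (ordE hF cn0) -EFinD -!EFin_max /=.
rewrite !(vgeE hF) mulf_eq0 (negPf u0) (negPf cn0) /= (valM hF) // !ge_max lerBlDr -andbA.
by split=> [/and3P[-> -> ->]|[-> -> ->]].
Qed.

(* For t = c / pi^b the hypotheses say that s = p + q x and s x lie in the lattice
   spanned by pi^a and pi^b x + c; eliminating p leaves q * normf t 1 in (pi^a),
   where normf t 1 has valuation 2 min(0, ord t) by anisotropy. *)
Lemma conductor_system a (p q t : F) :
  vge a (p - q * t) -> vge a (- (nrx * q) - (p + trx * q) * t) ->
  [/\ vge a p, vge a q, vge a (p * t) & vge a (q * t)].
Proof.
move=> h1 h2; have hT := trx_int hF hpi hdim hgen; have hN := nrx_int hF hpi hdim hgen.
have aniso := @normf_anisotropic _ _ hF _ hpi _ hdim hunr _ hgen.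
have not11 : ~~ vge 1 1 by rewrite vgeE // oner_eq0 val1.
case: (boolP (vge 0 t)) => ht.
  have n0 : vge 0 (normf x t 1) := vge_normf hF hpi hdim hgen ht v1.
  have n1 : ~~ vge 1 (normf x t 1).
    by apply/negP => /(aniso _ _ ht v1)[_]; exact/negP.
  have hq : vge a q.
    rewrite -(vge_unit hF q n0 n1) (_ : _ * q =
      - (- (nrx * q) - (p + trx * q) * t) - t * (p - q * t)); last by rewrite /normf; ring.
    by rewrite (vgeB hF) ?vgeN // (vgeMl hF).
  have hp : vge a p.
    by rewrite -(subrK (q * t) p) (vgeD hF) // (vgeMr hF).
  by split=> //; apply: (vgeMr hF).
have t0 : t != 0 by apply: contraNneq ht => ->; exact: v0.
have hr : vge 1 t^-1.
  by move: ht; rewrite !vgeE // invr_eq0 (negPf t0) /= (valV hF) //; clear; lia.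
have hr0 : vge 0 t^-1 by apply: (vge_le hF _ hr).
have n0 : vge 0 (normf x 1 t^-1) := vge_normf hF hpi hdim hgen v1 hr0.
have n1 : ~~ vge 1 (normf x 1 t^-1).
  by apply/negP => /(aniso _ _ v1 hr0)[]; rewrite (negPf not11).
have hqt : vge a (q * t).
  rewrite -(vge_unit hF _ n0 n1) (_ : _ * (q * t) =
      t^-1 * - (- (nrx * q) - (p + trx * q) * t) - (p - q * t)).
    by rewrite (vgeB hF) // (vgeMl hF) // vgeN.
  by rewrite /normf; field.
have hq : vge a q.
  by rewrite -(mulfK t0 q); apply: (vgeMr hF).
have hp : vge a p by rewrite -(subrK (q * t) p) (vgeD hF).
split=> //; rewrite (_ : p * t =
  - (nrx * q) - trx * (q * t) - (- (nrx * q) - (p + trx * q) * t)); last by ring.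
apply: (vgeB hF) => //; apply: (vgeB hF); last exact: (vgeMl hF).
by rewrite vgeN // (vgeMl hF).
Qed.

(** An element u = (r, p + q x) is tested on the basis (1,0), (0,1), (0,x) of the maximal order. The
    first gives r in (pi^a); the defects of the other two products are the two hypotheses of
    [conductor_system] with t = c / pi^b. *)
Lemma Oset_conductor a b c : vge 0 c ->
  conductor (maxorder ord L) (Oset a b c) =
  ppow ord pi a%:Z `*` ppowL ord pi L
    (fine (maxe (maxe a%:Z%:E b%:Z%:E) (a%:Z%:E + b%:Z%:E - ord c))%E).
Proof.
move=> hc; have hT := trx_int hF hpi hdim hgen; have hN := nrx_int hF hpi hdim hgen.
apply/seteqP; split=> u.
  move=> [/maxorderP[u1 p0 q0] cond].
  have maxE (r p q : F) : vge 0 r -> vge 0 p -> vge 0 q -> maxorder ord L (elt r p q).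
    by move=> *; apply/maxorderP; rewrite c0elt c1elt.
  have [_ _] := cond _ (maxE 1 0 0 v1 (v0 0) (v0 0)).
  have [_] := cond _ (maxE 0 1 0 (v0 0) v1 (v0 0)).
  have [_] := cond _ (maxE 0 0 1 (v0 0) (v0 0) v1).
  rewrite /defect /wc /= !c0M !c1M !c0E // !c1E //.
  rewrite !(mulr0, mulr1, mul0r, addr0, add0r, subr0, sub0r) !vge_divn //.
  rewrite !add0r oppr0 sub0r vgeN //.
  set t := c / pi ^+ b.
  rewrite -(mulrAC _ c) -(mulrAC _ c) -!(mulrA _ c) -/t => hb1 h2 hb2 h1 ha.
  have [hp hq hpt hqt] := conductor_system h1 h2.
  have hb0 : vge b (c0 x u.2).
    rewrite -(addrK (trx * c1 x u.2) (c0 x u.2)) (vgeB hF) // (vgeMl hF) //.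
  have pt s : s * t = s * c / pi ^+ b by rewrite /t mulrA.
  split; first exact/(ppowE hF hpi).
  by apply/ppowLP; split; apply/vge_conductor_exponent; rewrite // -(vge_divn hF hpi) -pt.
move=> [/(ppowE hF hpi) hu /ppowLP[]].
move=> /vge_conductor_exponent[//|p1 p2 p3] /vge_conductor_exponent[//|q1 q2 q3].
have ge0 (n : nat) (s : F) : vge n s -> vge 0 s by apply: (vge_le hF); clear; lia.
split.
  by apply/maxorderP; split; apply: ge0; eassumption.
move=> z /maxorderP[z1 z2 z3]; rewrite /Oset /= /defect /wc /= c0M c1M; split.
- by apply: (vgeMl hF) => //; apply: ge0; eassumption.
- rewrite vge_divn // add0r; apply: (vgeD hF); first apply: (vgeD hF).
  + exact: (vgeMr hF).
  + exact: (vgeMr hF).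
  + by apply: (vgeMr hF) => //; apply: (vgeMl hF).
rewrite (_ : (_ + _ + _) / pi ^+ b * c = c1 x z.2 * (c0 x u.2 * c / pi ^+ b)
  + c0 x z.2 * (c1 x u.2 * c / pi ^+ b) + trx * c1 x z.2 * (c1 x u.2 * c / pi ^+ b)); last first.
  by field; rewrite expf_neq0.
rewrite -!(vge_divn hF hpi) in p3 q3.
apply: (vgeB hF); last first.
  by apply: (vgeD hF); first apply: (vgeD hF); apply: (vgeMl hF) => //; apply: (vgeMl hF).
apply: (vgeB hF); last by apply: (vgeMr hF).
by apply: (vgeB hF); apply: (vgeMr hF) => //; apply: (vgeMl hF).
Qed.

(** * Inclusion of orders *)

(** Everything comes from the single congruence of c with w = pi^(b-b') c' modulo pi^a'. If ord(c)
    >= a', it no longer involves c, and the entry ceil(a'/2) of the maximum is the order condition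
    on c'. If ord(c) < a', it forces ord(w) = ord(c). *)
Lemma inclusion_criterion a b c a' b' c' :
  vge 0 c' -> (uphalf a' <= b')%N -> vge (uphalf a') c' ->
  (Oset a b c `<=` Oset a' b' c' <->
   [/\ (a' <= a)%N, (b' <= b)%N,
       ((a'%:Z%:E <= ord c)%E ->
          ppow ord pi (Num.max (uphalf a')%:Z (a'%:Z - (b%:Z - b'%:Z))) c')
     & ((ord c < a'%:Z%:E)%E ->
          ppow ord pi (a'%:Z - (b%:Z - b'%:Z)) (c' - pi ^ (- (b%:Z - b'%:Z)) * c))])
  /\ (Oset a b c `<=` Oset a' b' c' -> (ord c < a'%:Z%:E)%E ->
      [/\ ((uphalf a')%:Z%:E <= ord c - (b%:Z - b'%:Z)%R%:E)%E,
          (ord c - (b%:Z - b'%:Z)%R%:E)%E = ord c'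
        & 0 < a'%:Z - (b%:Z - b'%:Z)]).
Proof.
move=> hc' hb' hac'.
have piE : pi ^ (b%:Z - b'%:Z) = pi ^+ b / pi ^+ b' by rewrite expfzDr // -exprnN.
have leE k u : (k%:E <= ord u)%E = vge k u by [].
have ltE k u : (ord u < k%:E)%E = ~~ vge k u by rewrite ltNge.
have shift : vge a' (c - pi ^+ b / pi ^+ b' * c') =
    vge (a'%:Z - (b%:Z - b'%:Z)) (c' - pi ^ (- (b%:Z - b'%:Z)) * c).
  rewrite -piE -(vge_pi hF hpi) -(vgeN hF); congr (vge _ _).
  by rewrite mulrBr mulrA -expfzDr // subrr mul1r opprB.
split.
  rewrite leE ltE; split=> [/Oset_subset[ha hb h]|[ha hb h1 h2]].
    split=> // hc; apply/(ppowE hF hpi); last by rewrite -shift.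
    have : vge a' (pi ^+ b / pi ^+ b' * c').
      by rewrite -(subKr c (_ * c')) (vgeB hF).
    rewrite -piE vge_pi // => h3.
    by rewrite /Num.max; case: ifP.
  apply/Oset_subset; split=> //; case: (boolP (vge a' c)) => hc.
    apply: (vgeB hF) => //; rewrite -piE vge_pi //.
    by move/(ppowE hF hpi): (h1 hc); apply: (vge_le hF); clear; lia.
  by rewrite shift; apply/(ppowE hF hpi); exact: h2.
rewrite ltE => /Oset_subset[ha hb h] hc.
have cn0 : c != 0 by apply: contraNneq hc => ->; exact: v0.
set w := pi ^+ b / pi ^+ b' * c' in h.
have wc_ge k : (k <= a'%:Z) -> vge k w = vge k c.
  move=> ka; rewrite -(subrK w c) addrC (vgeDl hF) //; exact: (vge_le hF _ h).
have w0 : w != 0.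
  by apply: contraNneq hc => w0; rewrite -wc_ge // w0 v0.
have cn0' : c' != 0 by apply: contraNneq w0 => c0; rewrite /w c0 mulr0.
have vw : val ord w = b%:Z - b'%:Z + val ord c'.
  by rewrite /w -piE (valM hF (piX_neq0 hF hpi _) cn0') (val_piX hF hpi).
have vcw : val ord c = val ord w.
  have := wc_ge (val ord c); have := wc_ge (val ord w); move: hc.
  rewrite !(vgeE hF) (negPf w0) (negPf cn0) /= => h1 h2 h3.
  have := wc_ge a'; rewrite !(vgeE hF) (negPf w0) (negPf cn0) /=.
  by move: h1 h2 h3; clear; lia.
move: hc hac' hc'; rewrite !(vgeE hF) (negPf cn0) (negPf cn0') /= => hc hac' hc'.
have e : val ord c - (b%:Z - b'%:Z) = val ord c' by move: vw vcw; clear; lia.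
have pos : 0 < a'%:Z - (b%:Z - b'%:Z) by move: hc hc' e; clear; lia.
by rewrite !(ordE hF) // -EFinB e; split.
Qed.

(** * The Gorenstein property *)

Definition Oideal (O I : set E) : Prop :=
  [/\ I 0, forall y z, I y -> I z -> I (y + z) & forall r y, O r -> I y -> I (r * y)].

Lemma fractional_Oideal (O I : set E) : is_order ord O ->
  fractional_ideal O I -> Oideal O I.
Proof.
move=> [/subring_closedP[O1 _ OM] _ _ _] [[s ->] _]; split.
- exact: (@lspan0 E E^o).
- exact: (@lspanD E E^o).
move=> r y Or; move: y; apply: (@lspan_sub E E^o _ _
  [set y | lspan (V := E^o) O [set` s] (r * y : E)]) => [|y z hy hz|k g Ok sg].
- by rewrite /= mulr0; exact: (@lspan0 E E^o).
- by rewrite /= mulrDr; exact: (@lspanD E E^o).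
by rewrite /= mulrA; apply: (@lspanZ E E^o) => //; exact: OM.
Qed.

(** * Ideals with multiplier ring O *)

Section Ideals.
Variables (a b : nat) (c : F) (hc : vge 0 c).
Local Notation O := (Oset a b c).
Variables (Oord : is_order ord O) (I : set E) (hI : Oideal O I).
Implicit Types (r g : E) (u : F).

Let OM : is_submodule (V := E) (intring ord) O := Oset_submodule a b c.
Let I0 : I 0. Proof. by case: hI. Qed.
Let ID y z : I y -> I z -> I (y + z). Proof. by case: hI => _ + _; apply. Qed.
Let IM r y : O r -> I y -> I (r * y). Proof. by case: hI => _ _; apply. Qed.

Lemma Oset_scal u : vge 0 u -> O u%:A.
Proof. by case: OM => _ _ + hu; apply=> //; exact: Oset1. Qed.

Lemma idealZ u y : vge 0 u -> I y -> I (u *: y).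
Proof. by move=> hu Iy; rewrite -mulr_algl; apply: IM => //; exact: Oset_scal. Qed.

Definition piI y : Prop := I (pi^-1 *: y).

Lemma piID y z : piI y -> piI z -> piI (y + z).
Proof. by rewrite /piI scalerDr; exact: ID. Qed.

Lemma piIZ u y : vge 0 u -> piI y -> piI (u *: y).
Proof. by move=> hu; rewrite /piI scalerA mulrC -scalerA; exact: idealZ. Qed.

Lemma piIM r y : O r -> piI y -> piI (r * y).
Proof. by move=> hr; rewrite /piI scalerAr; exact: IM. Qed.

Lemma piI_max u y : vge 1 u -> I y -> piI (u *: y).
Proof.
move=> hu Iy; rewrite /piI scalerA; apply: idealZ => //.
by rewrite -[pi^-1]/(pi ^ (-1)) (vge_pi hF hpi).
Qed.

Lemma piI_unit u y : vge 0 u -> ~~ vge 1 u -> piI (u *: y) -> piI y.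
Proof.
move=> hu hu1 /(@piIZ u^-1); rewrite scalerA mulVf ?scale1r; last first.
  by apply: contraNneq hu1 => ->; exact: v0.
by apply; rewrite -(vge_unit hF _ hu hu1) divff ?v1 //; apply: contraNneq hu1 => ->; exact: v0.
Qed.

Lemma piI_addl y z : piI z -> piI (y + z) -> piI y.
Proof.
move=> hz hyz; rewrite -(addrK z y) -scaleN1r; apply: piID => //.
by apply: piIZ => //; rewrite vgeN.
Qed.

(** If r I were contained in pi I, then r / pi would multiply I into itself. *)
Lemma not_multiplier r : multiplier I = O -> ~ O (pi^-1 *: r) ->
  exists2 g, I g & ~ piI (r * g).
Proof.
move=> mI nO; apply: contrapT => h; apply: nO; rewrite -mI => g Ig.
by apply: contrapT => hn; apply: h; exists g => //; rewrite /piI scalerAl.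
Qed.

Lemma primitive_multiple y : ~ O y -> exists k : nat,
  O (pi ^+ k.+1 *: y) /\ ~ O (pi ^+ k *: y).
Proof.
move=> nO; have ex : exists k, `[< O (pi ^+ k *: y) >].
  by have [k hk] := Oset_absorbs a b c y; exists k; apply/asboolP.
case: (ex_minnP ex) => -[|k] /asboolP Ok kmin; first by rewrite expr0 scale1r in Ok.
by exists k; split=> // /asboolP/kmin; rewrite ltnn.
Qed.

(** Serves to show that the chosen g is no zero divisor: a nonzero y with y g = 0 could be scaled to
    a primitive element of O, still killing g. *)
Lemma not_infinitely_divisible y : y != 0 -> exists k : nat, ~ O (pi ^- k *: y).
Proof.
move=> y0.
suff [k hk] : exists k : nat,
    [|| ~~ vge k y.1, ~~ vge k (c0 x y.2) | ~~ vge k (c1 x y.2)].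
  exists k => /(Oset_int hc)[] /=; rewrite c0Z c1Z -[pi ^- k *: y.1]/(pi ^- k * y.1 : F).
  rewrite 3!(mulrC (pi ^- k)) !(vge_divn hF hpi) !add0r => h1 h2 h3.
  have h3' : vge k (c1 x y.2) by apply: (vge_le hF _ h3); clear; lia.
  by move: hk; rewrite h1 h2 h3'.
have [e1|/(vge_unbounded hF)[k hk]] := eqVneq (y.1 : F) 0; last by exists k; rewrite hk.
have [e2|/(vge_unbounded hF)[k hk]] := eqVneq (c0 x y.2) 0; last by exists k; rewrite hk orbT.
have [e3|/(vge_unbounded hF)[k hk]] := eqVneq (c1 x y.2) 0; last by exists k; rewrite hk !orbT.
by case/eqP: y0; apply: elt_inj; rewrite /= ?c00 ?c10.
Qed.

(* If no primitive element of O (one outside pi O) sends g into pi I, then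
   g is a unit of E and I = g O: an element y of I outside g O would give
   a primitive r = pi^(k+1) (y / g) with r g in pi I. *)
Lemma principal_invertible g : I g ->
  (forall r, O r -> ~ O (pi^-1 *: r) -> ~ piI (r * g)) -> invertible O I.
Proof.
move=> Ig prim; have [/subring_closedP[O1 _ OMul] _ _ Ofull] := Oord.
have piV k y : pi^-1 *: (pi ^+ k.+1 *: y) = pi ^+ k *: y.
  by rewrite scalerA exprS mulKf.
have reg y : y != 0 -> y * g != 0.
  move=> y0; apply/eqP => yg0.
  have [j /primitive_multiple[k [h1 h2]]] := not_infinitely_divisible y0.
  apply: (prim _ h1); first by rewrite piV.
  by rewrite -!scalerAl yg0 /piI !scaler0.
have g1 : (g.1 : F) != 0.
  apply/eqP => g10; have /reg/eqP[] : ((1, 0) : E) != 0.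
    by apply/eqP => -[/eqP]; rewrite oner_eq0.
  by apply: elt_inj; rewrite /= ?mul0r // -[1 * g.1]/((1 : F) * g.1) g10 mulr0.
have g2 : g.2 != 0.
  apply/eqP => g20; have /reg/eqP[] : ((0, 1) : E) != 0.
    by apply/eqP => -[/eqP]; rewrite oner_eq0.
  by apply: elt_inj; rewrite /= ?g20 ?mulr0 // -[0 * g.1]/((0 : F) * g.1) mul0r.
pose gi : E := ((g.1 : F)^-1, g.2^-1).
have gK : g * gi = 1.
  by rewrite /gi; congr pair; [exact: (@divff F)|exact: divff].
have IgO y : I y -> O (gi * y).
  move=> Iy; apply: contrapT => /primitive_multiple[k [h1 h2]].
  apply: (prim _ h1); first by rewrite piV.
  rewrite /piI -scalerAl piV mulrAC [gi * g]mulrC gK mul1r.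
  by apply: idealZ => //; rewrite vge_piXn.
pose J : set E := [set y | O (g * y)].
have [_ OD OZ] := OM.
have JM : is_submodule (V := E) (intring ord) J.
  split=> [|y z|k y hk]; rewrite /J /= ?mulr0 ?mulrDr -?scalerAr.
  - by case: OM.
  - exact: OD.
  - exact: OZ.
exists J.
  split.
    exists [:: gi]; apply/seteqP; split=> y.
      move=> Jy; have -> : y = (g * y) *: (gi : E^o).
        by rewrite -[RHS]/((g * y) * gi) mulrAC gK mul1r.
      by apply: (@lspanZ E E^o) => //=; rewrite inE.
    apply: (@lspan_sub E E^o _ _ J) => [|z z'|k z Ok].
    - by case: JM.
    - by case: JM => _ + _; apply.
    rewrite /= inE => /eqP ->.
    by rewrite /J /= -[k *: _]/(k * gi) mulrCA gK mulr1.
  apply/(lspan_full JM) => y; have [k hk] := Oset_absorbs a b c (g * y).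
  by exists k; rewrite /J /= -scalerAr.
apply/seteqP; split=> y.
  apply: (@lspan_sub E E^o _ _ O) => [|z z'|k z Ik Jz].
  - by case: OM.
  - exact: OD.
  have -> : (k *: z : E^o) = (gi * k) * (g * z).
    rewrite -[k *: z]/(k * z) mulrACA [gi * g]mulrC gK mul1r //.
  by apply: OMul => //; exact: IgO.
move=> Oy; have -> : y = (y * g) *: (gi : E^o).
  by rewrite -[RHS]/((y * g) * gi) -mulrA gK mulr1.
apply: (@lspanZ E E^o); first exact: IM.
by rewrite /J /= gK.
Qed.

End Ideals.

Definition idem0 : E := elt 1 0 0.
Definition idem1 : E := elt 0 1 0.

(* Here O = o x o[pi^b x], and each component of I is treated separately. *)
Lemma gorenstein_product b c : vge 0 c -> gorenstein (Oset 0 b c).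
Proof.
move=> hc; have -> : Oset 0 b c = Oset 0 b 0 by apply/Oset_eq; rewrite sub0r vgeN.
have Oord : is_order ord (Oset 0 b 0).
  by apply/Oset_is_order; rewrite ?v0 //.
have [/subring_closedP[_ _ OMul] _ _ _] := Oord.
have hT := trx_int hF hpi hdim hgen; have hN := nrx_int hF hpi hdim hgen.
have hv0 := v0 0.
have OE u p q : Oset 0 b 0 (elt u p q) <-> [/\ vge 0 u, vge b q & vge 0 (p - u)].
  by rewrite OsetP mulr0 subr0.
have piOE u p q : Oset 0 b 0 (pi^-1 *: elt u p q) <->
    [/\ vge 1 u, vge (b%:Z + 1) q & vge 1 (p - u)].
  have -> : pi^-1 *: elt u p q = elt (u / pi ^+ 1) (p / pi ^+ 1) (q / pi ^+ 1).
    apply: elt_inj; rewrite /= ?c0Z ?c1Z ?c0E ?c1E // ?expr1 1?mulrC //.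
  by rewrite OE -mulrBl !(vge_divn hF hpi).
move=> I fI mI; have hI := fractional_Oideal Oord fI.
have O0 : Oset 0 b 0 idem0 by apply/OE; rewrite sub0r vgeN // !(v0, v1).
have O1 : Oset 0 b 0 idem1 by apply/OE; rewrite subr0 !(v0, v1).
have n11 : ~~ vge 1 1 by rewrite vgeE // oner_eq0 val1.
have [i Ii hi] : exists2 g, I g & ~ piI I (idem0 * g).
  by apply: (not_multiplier mI) => /piOE[]; rewrite (negPf n11).
have idem0M y : idem0 * y = elt (y.1) 0 0.
  by apply: elt_inj; rewrite /= ?c0M ?c1M ?c0E ?c1E // ?mul1r //; ring.
have idem1M y : idem1 * y = elt 0 (c0 x y.2) (c1 x y.2).
  by apply: elt_inj; rewrite /= ?c0M ?c1M ?c0E ?c1E //; ring.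
have [j Ij hj] : exists2 g, I g & forall p w, vge 0 p -> vge 0 w ->
    piI I (elt 0 p (pi ^+ b * w) * g) -> vge 1 p /\ vge 1 w.
  case: b Oord OE piOE O0 O1 hI mI {hi Ii i fI OMul} => [|b'] Oord' OE' piOE' O0' O1' hI' mI'.
    (* Here b = 0. If p + w x has unit norm, multiplying it by its conjugate gives that unit times
       [idem1], which sends j outside pi I; otherwise anisotropy applies. *)
    have [j Ij hj] : exists2 g, I g & ~ piI I (idem1 * g).
      by apply: (not_multiplier mI') => /piOE'[_ _]; rewrite subr0 (negPf n11).
    exists j => // p w hp hw h; apply: (@normf_anisotropic _ _ hF _ hpi _ hdim hunr _ hgen) => //.
    apply: contrapT => /negP hn; apply: hj.
    have hn0 : vge 0 (normf x p w) := vge_normf hF hpi hdim hgen hp hw.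
    apply: (piI_unit hI' hn0 hn); rewrite scalerAl.
    have -> : normf x p w *: idem1 = elt 0 (p + trx * w) (- w) * elt 0 p (pi ^+ 0 * w).
      by apply: elt_inj; rewrite /= ?c0Z ?c1Z ?c0M ?c1M ?c0E ?c1E // /normf; ring.
    rewrite -mulrA; apply: (piIM hI') => //; apply/OE'; split=> //.
      by rewrite vgeN.
    by rewrite subr0 (vgeD hF) // (vgeMl hF).
  (* Here b > 0 and beta^2 lies in pi O. Multiplying p + w beta by beta isolates p; once p is in the
     maximal ideal, only w beta remains. *)
  pose beta := elt 0 0 (pi ^+ b'.+1).
  have Obeta : Oset 0 b'.+1 0 beta by apply/OE'; rewrite subr0 !v0 vge_piXn.
  have [j Ij hj] : exists2 g, I g & ~ piI I (beta * g).
    apply: (not_multiplier mI') => /piOE'[_ + _].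
    by rewrite vge_piXn //; clear; lia.
  exists j => // p w hp hw h.
  have hp1 : vge 1 p.
    apply: contrapT => /negP hn; apply: hj; apply: (piI_unit hI' hp hn).
    have /(piIM hI' Obeta) := h; rewrite mulrA.
    have -> : beta * elt 0 p (pi ^+ b'.+1 * w) = p *: beta + (pi * w) *:
        elt 0 (- nrx * (pi ^+ b' * pi ^+ b'.+1)) (pi ^+ b'.+1 * (trx * pi ^+ b')).
      by apply: elt_inj; rewrite /= ?c0D ?c1D ?c0Z ?c1Z ?c0M ?c1M ?c0E ?c1E // ?exprS; ring.
    rewrite mulrDl -!scalerAl; apply: (piI_addl hI'); apply: (piI_max hI').
      by rewrite (vgeMr hF) // -[pi]expr1 vge_piXn.
    have hX n : vge 0 (pi ^+ n) by rewrite vge_piXn.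
    case: hI' => _ _; apply=> //; apply/OE'; split=> //.
      by apply: (vgeMr hF); rewrite ?vge_piXn // (vgeMl hF).
    by rewrite subr0 mulNr vgeN // !(vgeMl hF).
  split=> //; apply: contrapT => /negP hn; apply: hj; apply: (piI_unit hI' hw hn).
  have -> : w *: (beta * j) = elt 0 p (pi ^+ b'.+1 * w) * j + (- p) *: (idem1 * j).
    rewrite !scalerAl -mulrDl; congr (_ * _).
    by apply: elt_inj; rewrite /= ?(c0E hdim, c1E hdim, c0D, c1D, c0Z, c1Z) //; ring.
  apply: (piID hI') => //; apply: (piI_max hI'); rewrite ?vgeN //.
  by case: hI' => _ _; apply.
have [_ ID IM] := hI.
apply: (principal_invertible hv0 Oord hI (g := idem0 * i + idem1 * j)).
  by apply: ID; apply: IM.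
have e00 : idem0 * idem0 = idem0 by rewrite idem0M.
have e01 : idem0 * idem1 = 0 by rewrite idem0M; apply: elt_inj; rewrite /= ?c0E ?c1E ?c00 ?c10.
have e11 : idem1 * idem1 = idem1 by rewrite idem1M c0elt c1elt.
move=> r Or nr h; apply: nr; have [r1 hw rd] := Or.
have hu : vge 1 r.1.
  apply: contrapT => /negP hn; apply: hi; apply: (piI_unit hI r1 hn).
  have := piIM hI O0 h; congr piI.
  rewrite mulrCA mulrDr !mulrA e00 e01 mul0r addr0 mulrA [r * _]mulrC (idem0M r) scalerAl.
  congr (_ * _); apply: elt_inj; rewrite /= ?c0Z ?c1Z ?c0E ?c1E ?mulr0 //.
  exact/esym/(@mulr1 F).
have hp : vge 0 (c0 x r.2) by have [] := Oset_int hv0 Or.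
have [] := hj (c0 x r.2) (wc b r) hp hw.
  have := piIM hI O1 h; congr piI.
  rewrite -c1wc mulrCA mulrDr !mulrA [idem1 * idem0]mulrC e11 e01 mul0r add0r.
  by rewrite mulrA [r * _]mulrC (idem1M r).
move=> hp1 hw1; rewrite (eltE r); apply/piOE; split=> //; last exact: (vgeB hF).
by rewrite (c1wc b) (vge_pin hF hpi); apply: (vge_le hF _ hw1); clear; lia.
Qed.

(* The case O = o[beta] with beta = (0, pi^b x + c) nilpotent modulo pi: some g in I
   has beta^2 g outside pi I, for otherwise beta^2 / pi would multiply I into itself. *)
Lemma gorenstein_monogenic a b c : (0 < a)%N -> (uphalf a <= b)%N -> vge (uphalf a) c ->
  ~~ vge (a%:Z + 1) (normf x c (pi ^+ b)) -> gorenstein (Oset a b c).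
Proof.
move=> a0 hab hac hn.
have a1 : (1 <= (uphalf a)%:Z)%R by move: a0; clear; lia.
have hc1 : vge 1 c by apply: (vge_le hF _ hac).
have hc : vge 0 c by apply: (vge_le hF _ hc1).
have hb1 : vge 1 (pi ^+ b) by rewrite vge_piXn //; move: a1 hab; clear; lia.
have hb : vge 0 (pi ^+ b) by apply: (vge_le hF _ hb1).
have hT := trx_int hF hpi hdim hgen; have hN := nrx_int hF hpi hdim hgen.
have Oord : is_order ord (Oset a b c) by apply/Oset_is_order.
have [/subring_closedP[_ _ OMul] _ _ _] := Oord.
have hna : vge a (normf x c (pi ^+ b)).
  have hpb : vge (uphalf a)%:Z (pi ^+ b) by rewrite vge_piXn.
  have hle : a%:Z <= (uphalf a)%:Z + (uphalf a)%:Z by clear; lia.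
  exact: (vge_le hF hle (vge_normf hF hpi hdim hgen hac hpb)).
pose n' := normf x c (pi ^+ b) / pi ^+ a.
have nE : normf x c (pi ^+ b) = pi ^+ a * n' by rewrite /n' mulrC divfK // expf_neq0.
have hn' : vge 0 n' by rewrite /n' (vge_divn hF hpi) add0r.
have hn'1 : ~~ vge 1 n' by rewrite /n' (vge_divn hF hpi) addrC.
pose s := trx * pi ^+ b + c + c.
have hs : vge 1 s by rewrite !(vgeD hF) // (vgeMl hF).
have hs0 : vge 0 s by apply: (vge_le hF _ hs).
pose alpha := elt 0 (pi ^+ a) 0; pose beta := elt 0 c (pi ^+ b).
have Oalpha : Oset a b c alpha.
  by apply/OsetP; rewrite !mul0r !subr0 !v0 vge_piXn.
have Obeta : Oset a b c beta.
  by apply/OsetP; rewrite divff ?expf_neq0 // mul1r subr0 subrr !v0 vge_piXn.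
(* Modulo pi this relation and the next read alpha beta = 0 and beta^2 = - n' alpha with n' a unit,
   so that beta^3 = 0. *)
have eab : alpha * beta = pi ^+ a *: beta.
  by apply: elt_inj; rewrite /= ?c0Z ?c1Z ?c0M ?c1M ?(c0E hdim, c1E hdim) //; ring.
have ebb : beta * beta = s *: beta + (- n') *: alpha.
  apply: elt_inj; rewrite /= ?(c0M, c1M) ?(c0E hdim, c1E hdim, c0D, c1D, c0Z, c1Z) //.
  - by ring.
  - rewrite (_ : - n' * _ = - normf x c (pi ^+ b)); last by rewrite nE; ring.
    by rewrite /normf /s; ring.
  - by rewrite /s; ring.
move=> I fI mI; have hI := fractional_Oideal Oord fI.
have [I0 ID IM] := hI.
(* The defect of beta^2 is minus the norm, which is not in (pi^(a+1)); hence beta^2 / pi is outside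
   O. *)
have [g Ig hg] : exists2 g, I g & ~ piI I (beta * beta * g).
  apply: (not_multiplier mI) => -[_ _].
  rewrite defectZ defectM /defect /wc c0elt c1elt /= divff ?expf_neq0 // mul1r subr0 subrr.
  rewrite !mul0r !subr0 addr0 !mul1r sub0r mulrN vgeN // mulrC -[pi]expr1 (vge_divn hF hpi).
  by rewrite (negPf hn).
apply: (principal_invertible hc Oord hI Ig) => r Or nr h; apply: hg.
have hpia : vge 1 (pi ^+ a) by rewrite vge_piXn //; move: a0; clear; lia.
have Ibg : I (beta * g) by exact: IM.
have Iag : I (alpha * g) by exact: IM.
have [r1 hw hd] := Or.
pose u : F := r.1; pose v := defect b c r / pi ^+ a; pose w := wc b r.
have hv : vge 0 v by rewrite /v (vge_divn hF hpi) add0r.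
have rE : r = u *: (1 : E) + v *: alpha + w *: beta := Oset_decomp a b c r.
have hab' : piI I (alpha * beta * g).
  by rewrite eab -scalerAl; exact: (piI_max hI).
have haab : piI I (alpha * (beta * (beta * g))).
  by rewrite mulrA eab -scalerAl; apply: (piI_max hI) => //; exact: IM.
have hbbb : piI I (beta * (beta * (beta * g))).
  rewrite mulrA ebb mulrDl -!scalerAl; apply: (piID hI).
    by apply: (piI_max hI) => //; exact: IM.
  by apply: (piIZ hI); rewrite ?vgeN // mulrA.
have rgE : r * g = u *: g + (v *: (alpha * g) + w *: (beta * g)).
  by rewrite rE !mulrDl -!scalerAl mul1r addrA.
(* Multiplication of r g by beta^2, then by beta, isolates u and w in turn. If both are in the
   maximal ideal, v is a unit because r is primitive; then alpha g lies in pi I, and so does beta^2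
   g. *)
rewrite rgE in h; case: (boolP (vge 1 u)) => hu1; last first.
  apply: (piI_unit hI r1 hu1); have := piIM hI Obeta (piIM hI Obeta h).
  rewrite !mulrDr -!scalerAr [beta * (alpha * g)]mulrCA [beta * (alpha * _)]mulrCA.
  rewrite [beta * (beta * g) in X in piI _ (X + _)]mulrA; apply: (piI_addl hI).
  by apply: (piID hI); apply: (piIZ hI).
have {}h : piI I (w *: (beta * g) + v *: (alpha * g)).
  by move: h; rewrite addrC [_ + w *: _]addrC; apply: (piI_addl hI); exact: (piI_max hI).
case: (boolP (vge 1 w)) => hw1; last first.
  apply: (piI_unit hI hw hw1); have := piIM hI Obeta h.
  rewrite mulrDr -!scalerAr [beta * (alpha * g)]mulrCA !mulrA; apply: (piI_addl hI).
  exact: (piIZ hI).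
have hv1 : ~~ vge 1 v.
  apply/negP => hv1; apply: nr; split.
  - by rewrite -[(_ *: r).1]/(pi^-1 * u : F) mulrC -[pi]expr1 (vge_divn hF hpi).
  - by rewrite wcZ mulrC -[pi]expr1 (vge_divn hF hpi).
  - rewrite defectZ mulrC -[pi]expr1 (vge_divn hF hpi) addrC.
    by move: hv1; rewrite /v (vge_divn hF hpi).
have hag : piI I (alpha * g).
  apply: (piI_unit hI hv hv1); move: h; rewrite addrC; apply: (piI_addl hI).
  exact: (piI_max hI).
rewrite ebb mulrDl -!scalerAl; apply: (piID hI); first exact: (piI_max hI).
by apply: (piIZ hI); rewrite ?vgeN.
Qed.

(* For a >= 1 and norm of pi^b x + c divisible by pi^(a+1), the dual of O has multiplier
   ring O but needs two generators.  It is spanned by (1, pi^b x' - c), (pi^a, 0)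
   and (0, pi^a), where x' = x - trx. *)
Section DualIdeal.
Variables (a b : nat) (c : F).
Hypotheses (hab : (uphalf a <= b)%N) (hac : vge (uphalf a) c).
Local Notation O := (Oset a b c).
Let d : F := - (c + trx * pi ^+ b).

Definition dual_defect (y : E) : F := c0 x y.2 - wc b y * d.

(** The dual of O for the form (y, z) -> l(y z) with l(y) = (wc(y) - y.1) / pi^a. The three
    conditions are integrality of l on the products of y with (0, pi^a), 1 and (0, pi^b x + c), in
    this order. *)
Definition dual_ideal : set E :=
  [set y | [/\ vge 0 (wc b y), vge a (wc b y - y.1) & vge a (dual_defect y)]].

Let hc : vge 0 c.
Proof. by apply: (vge_le hF _ hac); clear; lia. Qed.
Let hT : vge 0 trx := trx_int hF hpi hdim hgen.
Let hN : vge 0 nrx := nrx_int hF hpi hdim hgen.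
Let hb : vge 0 (pi ^+ b).
Proof. by rewrite vge_piXn. Qed.
Let hd : vge 0 d.
Proof. by rewrite /d vgeN // (vgeD hF) // (vgeMl hF). Qed.
Let hn : vge a (normf x c (pi ^+ b)).
Proof.
have hpb : vge (uphalf a)%:Z (pi ^+ b) by rewrite vge_piXn.
have hle : a%:Z <= (uphalf a)%:Z + (uphalf a)%:Z by clear; lia.
exact: (vge_le hF hle (vge_normf hF hpi hdim hgen hac hpb)).
Qed.
Let Oord : is_order ord O.
Proof. by apply/Oset_is_order. Qed.
Let leN (k : nat) u : vge k u -> vge 0 u.
Proof. by apply: (vge_le hF); clear; lia. Qed.

(** Isolates the action of p through the scalar [p.1]; for p in O and z in the dual the other terms
    lie in (pi^a). The formula for [dual_defect] below has the same shape. *)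
Lemma wcM_dual (p z : E) : wc b (p * z) =
  (p.1 : F) * wc b z + (defect b c p * wc b z + wc b p * dual_defect z).
Proof.
rewrite wcM (c0defect b c p) (_ : c0 x z.2 = dual_defect z + wc b z * d).
  by rewrite /d; ring.
by rewrite /dual_defect; ring.
Qed.

Lemma dual_defectM (p z : E) : dual_defect (p * z) =
  (p.1 : F) * dual_defect z +
  ((defect b c p + wc b p * (c - d)) * dual_defect z
    - wc b p * wc b z * normf x c (pi ^+ b)).
Proof.
rewrite {1}/dual_defect wcM_dual /= c0M !(c1wc b) (c0defect b c p) /normf.
rewrite (_ : c0 x z.2 = dual_defect z + wc b z * d); last by rewrite /dual_defect; ring.
by rewrite /d; ring.
Qed.

Lemma dual_submodule : is_submodule (V := E) (intring ord) dual_ideal.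
Proof.
split=> [|y z [h1 h2 h3] [h1' h2' h3']|k y hk [h1 h2 h3]].
- by rewrite /dual_ideal /dual_defect /wc /= c00 c10 !mul0r !subr0 !v0.
- split; rewrite /dual_defect wcD /=; first exact: (vgeD hF).
    rewrite (_ : _ - _ = (wc b y - y.1) + (wc b z - z.1)); last by ring.
    exact: (vgeD hF).
  rewrite c0D (_ : _ - _ = dual_defect y + dual_defect z); last by rewrite /dual_defect; ring.
  exact: (vgeD hF).
- split; rewrite /dual_defect wcZ /=; first exact: (vgeMl hF).
    rewrite (_ : _ - _ = k * (wc b y - y.1)); first exact: (vgeMl hF).
    by rewrite -[k *: y.1]/(k * y.1 : F); ring.
  rewrite c0Z (_ : _ - _ = k * dual_defect y); last by rewrite /dual_defect; ring.
  exact: (vgeMl hF).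
Qed.

Lemma dual_stable p z : O p -> dual_ideal z -> dual_ideal (p * z).
Proof.
move=> [p1 pw pd] [zw z1 zd].
have pd0 := leN pd; have zd0 := leN zd.
split.
- rewrite wcM_dual; apply: (vgeD hF); first exact: (vgeMl hF).
  by apply: (vgeD hF); exact: (vgeMl hF).
- rewrite wcM_dual /= (_ : _ - _ = (p.1 : F) * (wc b z - z.1) +
    (defect b c p * wc b z + wc b p * dual_defect z)).
    apply: (vgeD hF); first exact: (vgeMl hF).
    by apply: (vgeD hF); [exact: (vgeMr hF)|exact: (vgeMl hF)].
  by rewrite -[p.1 * z.1 : F^o]/((p.1 : F) * z.1); ring.
rewrite dual_defectM; apply: (vgeD hF); first exact: (vgeMl hF).
apply: (vgeB hF); last by apply: (vgeMl hF) => //; exact: (vgeMl hF).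
apply: (vgeMl hF) => //; apply: (vgeD hF) => //; apply: (vgeMl hF) => //.
exact: (vgeB hF).
Qed.

Definition dual1 : E := elt 1 d (pi ^+ b).
Definition dual2 : E := elt (pi ^+ a) 0 0.
Definition dual3 : E := elt 0 (pi ^+ a) 0.

Lemma wc_dual1 : wc b dual1 = 1.
Proof. by rewrite /wc c1elt divff // expf_neq0. Qed.
Lemma wc_dual2 : wc b dual2 = 0.
Proof. by rewrite /wc c1elt mul0r. Qed.
Lemma wc_dual3 : wc b dual3 = 0.
Proof. by rewrite /wc c1elt mul0r. Qed.
Lemma dual_defect1 : dual_defect dual1 = 0.
Proof. by rewrite /dual_defect wc_dual1 c0elt mul1r subrr. Qed.
Lemma dual_defect2 : dual_defect dual2 = 0.
Proof. by rewrite /dual_defect wc_dual2 c0elt mul0r subr0. Qed.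
Lemma dual_defect3 : dual_defect dual3 = pi ^+ a.
Proof. by rewrite /dual_defect wc_dual3 c0elt mul0r subr0. Qed.

Lemma dual_mem1 : dual_ideal dual1.
Proof. by split; rewrite ?dual_defect1 ?wc_dual1 /= ?subrr ?v0 ?v1. Qed.
Lemma dual_mem2 : dual_ideal dual2.
Proof.
split; rewrite ?dual_defect2 ?wc_dual2 /= ?v0 //.
by rewrite sub0r vgeN // vge_piXn.
Qed.
Lemma dual_mem3 : dual_ideal dual3.
Proof. by split; rewrite ?dual_defect3 ?wc_dual3 /= ?subrr ?v0 // vge_piXn. Qed.

Lemma dual_fractional : fractional_ideal O dual_ideal.
Proof.
have [D0 DD DZ] := dual_submodule.
split; last first.
  apply/(lspan_full dual_submodule) => y.
  have [k1 h1] := vge_exists hF (wc b y); have [k2 h2] := vge_exists hF (wc b y - y.1).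
  have [k3 h3] := vge_exists hF (dual_defect y).
  exists (k1 + k2 + k3 + a)%N; split.
  - by rewrite wcZ (vge_pin hF hpi); apply: (vge_le hF _ h1); clear; lia.
  - rewrite wcZ (_ : _ - _ = pi ^+ (k1 + k2 + k3 + a) * (wc b y - y.1)).
      by rewrite (vge_pin hF hpi); apply: (vge_le hF _ h2); clear; lia.
    by rewrite -[(_ *: y).1]/(pi ^+ (k1 + k2 + k3 + a) * y.1 : F); ring.
  - rewrite (_ : dual_defect _ = pi ^+ (k1 + k2 + k3 + a) * dual_defect y).
      by rewrite (vge_pin hF hpi); apply: (vge_le hF _ h3); clear; lia.
    by rewrite /dual_defect wcZ /= c0Z; ring.
exists [:: dual1; dual2; dual3]; apply/seteqP; split=> y; last first.
  apply: (@lspan_sub E E^o _ _ dual_ideal) => [|z z'|k g Ok]; [exact: D0|exact: DD|].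
  by move=> /=; rewrite !inE => /or3P[]/eqP->; apply: dual_stable => //;
    [exact: dual_mem1|exact: dual_mem2|exact: dual_mem3].
move=> [h1 h2 h3].
have -> : y = ((wc b y)%:A : E) *: (dual1 : E^o)
   + ((((y.1 : F) - wc b y) / pi ^+ a)%:A : E) *: (dual2 : E^o)
   + ((dual_defect y / pi ^+ a)%:A : E) *: (dual3 : E^o).
  rewrite -![_ *: (_ : E^o)]/((_ : E) * (_ : E)) !mulr_algl.
  apply: elt_inj; rewrite /= ?(c0E hdim, c1E hdim, c0D, c1D, c0Z, c1Z) //.
  - rewrite -![_ *: (_ : F^o)]/(_ * _ : F); by field; rewrite expf_neq0.
  - by rewrite /dual_defect; field; rewrite expf_neq0.
  - by rewrite /wc; field; rewrite !expf_neq0.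
have Oscal u : vge 0 u -> O u%:A by case: Oord => _ + _ _; exact.
apply: (@lspanD E E^o); first apply: (@lspanD E E^o).
- by apply: (@lspanZ E E^o); [exact: Oscal|rewrite /= !inE eqxx].
- apply: (@lspanZ E E^o); last by rewrite /= !inE eqxx orbT.
  by apply: Oscal; rewrite (vge_divn hF hpi) add0r -vgeN // opprB.
- apply: (@lspanZ E E^o); last by rewrite /= !inE eqxx !orbT.
  by apply: Oscal; rewrite (vge_divn hF hpi) add0r.
Qed.

(** Multiplying (pi^a, 0), (0, pi^a) and (1, pi^b x' - c) by y yields, in this order, the three
    conditions that define O. *)
Lemma dual_multiplier : multiplier dual_ideal = O.
Proof.
apply/seteqP; split=> y; last by move=> Oy z; exact: dual_stable.
move=> my; have [_ h1 _] := my _ dual_mem1; have [_ h2 _] := my _ dual_mem2.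
have [h3 _ _] := my _ dual_mem3.
have [_ h4 _] := my _ dual_mem3.
split.
- move: h2; rewrite wcM_dual wc_dual2 dual_defect2 !mulr0 !addr0 sub0r vgeN //.
  rewrite -[(y * dual2).1]/((y.1 : F) * pi ^+ a).
  by rewrite mulrC (vge_pin hF hpi) subrr.
- move: h4; rewrite wcM_dual wc_dual3 dual_defect3 !mulr0 !add0r /=.
  rewrite -[y.1 * 0 : F^o]/((y.1 : F) * 0) mulr0 subr0.
  by rewrite mulrC (vge_pin hF hpi) subrr.
- move: h1; rewrite wcM_dual wc_dual1 dual_defect1 !mulr1 mulr0 addr0 /=.
  rewrite -[y.1 * 1 : F^o]/((y.1 : F) * 1) mulr1 addrAC subrr add0r //.
Qed.

(* Modulo the maximal ideal of O, both wc and dual_defect / pi^a are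
   O-linear forms on the dual, independent on dual1 and dual3; if 1 were a sum of
   products, some product k g would be a unit, and dual1, dual3 would both be
   multiples of k modulo the maximal ideal. *)
Lemma dual_not_invertible : (0 < a)%N ->
  vge (uphalf a.+1) c -> (uphalf a.+1 <= b)%N -> ~ invertible O dual_ideal.
Proof.
move=> a0 hc1 hb1 [J _ IJ].
have hn1 : vge (a%:Z + 1) (normf x c (pi ^+ b)).
  have hpb : vge (uphalf a.+1)%:Z (pi ^+ b) by rewrite vge_piXn.
  have hle : a%:Z + 1 <= (uphalf a.+1)%:Z + (uphalf a.+1)%:Z by clear; lia.
  exact: (vge_le hF hle (vge_normf hF hpi hdim hgen hc1 hpb)).
have c1' : vge 1 c by apply: (vge_le hF _ hc1); move: a0; clear; lia.
have b1' : vge 1 (pi ^+ b) by rewrite vge_piXn //; move: a0 hb1; clear; lia.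
have d1' : vge 1 d by rewrite /d vgeN // (vgeD hF) // (vgeMl hF).
have a1Z : (1 <= a%:Z)%R by move: a0; clear; lia.
have n11 : ~~ vge 1 1 by rewrite vgeE // oner_eq0 val1.
have wc_lin p z : O p -> dual_ideal z -> vge 1 (wc b (p * z) - (p.1 : F) * wc b z).
  move=> [p1 pw pd] [zw z1 zd]; rewrite wcM_dual addrAC subrr add0r.
  apply: (vgeD hF); first by apply: (vgeMr hF) => //; exact: (vge_le hF _ pd).
  by apply: (vgeMl hF) => //; exact: (vge_le hF _ zd).
have dd_lin p z : O p -> dual_ideal z ->
    vge (a%:Z + 1) (dual_defect (p * z) - (p.1 : F) * dual_defect z).
  move=> [p1 pw pd] [zw z1 zd]; rewrite dual_defectM addrAC subrr add0r.
  apply: (vgeB hF); last by apply: (vgeMl hF) => //; exact: (vgeMl hF).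
  rewrite addrC; apply: (vgeM hF) => //; apply: (vgeD hF); first exact: (vge_le hF _ pd).
  by apply: (vgeMl hF) => //; exact: (vgeB hF).
have IJO k g : dual_ideal k -> J g -> O (k * g).
  by move=> Ik Jg; rewrite -IJ; apply: (@lspanZ E E^o).
have [k Ik [g Jg hu]] : exists2 k, dual_ideal k & exists2 g, J g & ~~ vge 1 (k * g).1.
  apply: contrapT => hno.
  have : lspan (V := E^o) dual_ideal J `<=` [set y : E | vge 1 y.1].
    apply: (@lspan_sub E E^o _ _ [set y : E | vge 1 y.1]) => [|y z|k g Ik Jg].
    - exact: v0.
    - exact: (vgeD hF).
    apply: contrapT => /negP h; apply: hno; exists k => //; by exists g.
  by rewrite IJ => /(_ 1 (Oset1 a b c)); apply/negP.
have Okg := IJO _ _ Ik Jg; have u0 : vge 0 (k * g).1 by case: Okg.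
have O1g := IJO _ _ dual_mem1 Jg; have O3g := IJO _ _ dual_mem3 Jg.
(* Each product k g z is evaluated twice: k g acts on z, and z g acts on k. For z = [dual1] this
   makes the first component of [dual1 * g] a unit and puts the dual defect of k in (pi^(a+1)); for
   z = [dual3] it then puts pi^a there too. *)
have swap z : (k * g) * z = (z * g) * k by rewrite -mulrA mulrC [g * z]mulrC.
have w1 := wc_lin _ _ Okg dual_mem1; have w1' := wc_lin _ _ O1g Ik.
have e1 := dd_lin _ _ Okg dual_mem1; have e1' := dd_lin _ _ O1g Ik.
have e3 := dd_lin _ _ Okg dual_mem3; have e3' := dd_lin _ _ O3g Ik.
rewrite swap wc_dual1 in w1; rewrite swap dual_defect1 mulr0 subr0 in e1.
rewrite swap dual_defect3 in e3.
have q0 : vge 0 (dual1 * g).1 by case: O1g.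
have q30 : vge 0 (dual3 * g).1 by case: O3g.
have q1 : ~~ vge 1 (dual1 * g).1.
  apply: contraNN hu => hq; rewrite -[X in vge 1 X](mulr1 ((k * g).1 : F)).
  rewrite -(subKr (wc b (dual1 * g * k)) (_ * 1)); apply: (vgeB hF) => //.
  rewrite -(subrK ((dual1 * g).1 * wc b k) (wc b _)); apply: (vgeD hF) => //.
  by apply: (vgeMr hF) => //; case: Ik.
have hk : vge (a%:Z + 1) (dual_defect k).
  rewrite -(vge_unit hF _ q0 q1) -(subKr (dual_defect (dual1 * g * k)) (_ * _)).
  exact: (vgeB hF).
have : vge (a%:Z + 1) (pi ^+ a).
  rewrite -(vge_unit hF _ u0 hu) -(subKr (dual_defect (dual3 * g * k)) (_ * _)).
  apply: (vgeB hF) => //.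
  rewrite -(subrK ((dual3 * g).1 * dual_defect k) (dual_defect _)); apply: (vgeD hF) => //.
  exact: (vgeMl hF).
by rewrite vge_piXn //; clear; lia.
Qed.

End DualIdeal.

(** By evenness the negated conjunction says that pi^(a+1) does not divide the norm of pi^b x + c;
    for an order this means a = 2 min(b, ord(c)). *)
Lemma gorenstein_criterion a b c : (uphalf a <= b)%N -> vge (uphalf a) c ->
  gorenstein (Oset a b c) <->
  a = 0%N \/ ~ ((uphalf a.+1 <= b)%N /\ vge (uphalf a.+1) c).
Proof.
move=> hab hac; have hc : vge 0 c by apply: (vge_le hF _ hac); clear; lia.
split=> [gor|].
  have [->|a0] := eqVneq a 0%N; [by left|right=> -[hb1 hc1]].
  have a1 : (0 < a)%N by rewrite lt0n.
  have := dual_not_invertible a1 hc1 hb1.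
  by apply; apply: gor; [exact: dual_fractional|exact: dual_multiplier].
have [->|a0 [a00|h]] := eqVneq a 0%N; first by move=> _; exact: gorenstein_product.
  by rewrite a00 in a0.
apply: gorenstein_monogenic => //; first by rewrite lt0n.
apply/negP => hn; apply: h.
have hle : (uphalf a.+1)%:Z + (uphalf a.+1)%:Z - 1 <= a%:Z + 1 by clear; lia.
have [h1] := @normf_vge _ _ hF _ hpi _ hdim hunr _ hgen _ _ _ (vge_le hF hle hn).
by rewrite vge_piXn // => h2; split=> //; move: h2; clear; lia.
Qed.

End OrderCoordinates.

(** * The five statements *)

Theorem proposition5p1
  (F : fieldType) (ord : F -> \bar int) (hF : nonarch_local_field ord)
  (pi : F) (hpi : uniformizer ord pi)
  (L : fieldExtType F) (hdim : \dim {:L} = 2%N) (hunr : unramified ord L)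
  (x : L) (hx : intclosure_unit ord x)
  (hgen : intclosure ord L = adjoin ord x) :
  [/\ (* (1) *)
      (forall O : set (Ealg L), is_order ord O ->
         exists (a b : nat) (c : F),
           [/\ intring ord c,
               (a%:Z%:E <= 2%:E * mine b%:Z%:E (ord c))%E
             & O = Oabc ord pi x a b c])
      /\ (forall (a b : nat) (c : F), intring ord c ->
            (a%:Z%:E <= 2%:E * mine b%:Z%:E (ord c))%E ->
            is_order ord (Oabc ord pi x a b c)),
      (* (2) *)
      (forall (a b a' b' : nat) (c c' : F),
         intring ord c -> intring ord c' ->
         is_order ord (Oabc ord pi x a b c) ->
         is_order ord (Oabc ord pi x a' b' c') ->
         (Oabc ord pi x a b c `<=` Oabc ord pi x a' b' c' <->
          [/\ (a' <= a)%N, (b' <= b)%N,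
              ((a'%:Z%:E <= ord c)%E ->
                 ppow ord pi
                   (Num.max (uphalf a')%:Z (a'%:Z - (b%:Z - b'%:Z))) c')
            & ((ord c < a'%:Z%:E)%E ->
                 ppow ord pi (a'%:Z - (b%:Z - b'%:Z))
                   (c' - pi ^ (- (b%:Z - b'%:Z)) * c))])
         /\ (Oabc ord pi x a b c `<=` Oabc ord pi x a' b' c' ->
             (ord c < a'%:Z%:E)%E ->
             [/\ ((uphalf a')%:Z%:E <= ord c - (b%:Z - b'%:Z)%R%:E)%E,
                 (ord c - (b%:Z - b'%:Z)%R%:E)%E = ord c'
               & 0 < a'%:Z - (b%:Z - b'%:Z)])),
      (* (3) *)
      (forall (a b a' b' : nat) (c c' : F),
         intring ord c -> intring ord c' ->
         is_order ord (Oabc ord pi x a b c) ->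
         is_order ord (Oabc ord pi x a' b' c') ->
         (Oabc ord pi x a' b' c' = Oabc ord pi x a b c <->
          [/\ a = a', b = b' & ppow ord pi a%:Z (c - c')])),
      (* (4) *)
      (forall (a b : nat) (c : F), intring ord c ->
         is_order ord (Oabc ord pi x a b c) ->
         has_length (intring ord)
           (Oabc ord pi x a b c) (maxorder ord L) (a + b)
         /\ conductor (maxorder ord L) (Oabc ord pi x a b c) =
            ppow ord pi a%:Z `*`
            ppowL ord pi L
              (fine (maxe (maxe a%:Z%:E b%:Z%:E)
                          (a%:Z%:E + b%:Z%:E - ord c))%E))
    & (* (5) *)
      (forall (a b : nat) (c : F), intring ord c ->
         is_order ord (Oabc ord pi x a b c) ->
         (gorenstein (Oabc ord pi x a b c) <->
          ((a%:Z%:E <= ord c)%E -> a = (2 * b)%N \/ a = 0%N)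
          /\ ((ord c < a%:Z%:E)%E ->
                a%:Z%:E = (2%:E * mine b%:Z%:E (ord c))%E)))].
Proof.
have OE a b c := OabcE hF hpi hdim hgen a b c.
have order_iff a b c (hc : vge ord 0 c) :
    is_order ord (Oabc ord pi x a b c) <-> (uphalf a <= b)%N /\ vge ord (uphalf a) c.
  by rewrite OE; exact: (Oset_is_order hF hpi hdim hunr hgen).
split.
- split=> [O Oord|a b c hc /(order_bound hF)/(order_iff _ _ _ hc)//].
  have [a [b [c [hc OEq]]]] := order_Oset hF hpi hdim hunr hgen Oord.
  exists a, b, c; split=> //; last by rewrite OE.
  by apply/(order_bound hF); apply: (order_iff a b c hc).1; rewrite OE -OEq.
- move=> a b a' b' c c' hc hc' _ /(order_iff _ _ _ hc')[hb' hac'].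
  by rewrite !OE; apply: (inclusion_criterion hF hpi hdim hgen).
- move=> a b a' b' c c' hc hc' _ _; rewrite !OE.
  apply: (iff_trans (Oset_eq hF hpi hdim hgen a b c a' b' c')).
  by split=> -[ea eb h]; split=> //; apply/(ppowE hF hpi).
- move=> a b c hc _; rewrite OE; split.
    exact: (Oset_length hF hpi hdim hgen).
  exact: (Oset_conductor hF hpi hdim hunr hgen).
move=> a b c hc /(order_iff _ _ _ hc)[hb hac].
rewrite OE; apply: (iff_trans (gorenstein_criterion hF hpi hdim hunr hgen hb hac)).
have leE k u : (k%:E <= ord u)%E = vge ord k u by [].
(* For c = 0 only the case ord(c) >= a occurs, and the minimum is b. In general, 0 < a <= ord(c)
   gives 2 ord(c) > a, so a = 2 min(b, ord(c)) reduces to a = 2b. *)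
rewrite ltNge leE; have [c0|c0] := eqVneq c 0.
  rewrite c0 !(vge0 hF) in hac *; clear -hb.
  split=> [h|[h _]]; first by split=> // _; case: h => h; [right|left]; lia.
  have [] := h isT => e; last by left.
  by right=> -[]; lia.
rewrite (ordE hF c0) -EFin_min -EFinM !(vgeE hF) (negPf c0) /= in hac *.
have -> : (a%:Z%:E = (2 * Num.min b%:Z (val ord c))%:E :> \bar int) <->
    a%:Z = 2 * Num.min b%:Z (val ord c) by split=> [[]|->].
move: (val ord c) hb hac; clear => v hb hac.
by split=> [h|[h1 h2]]; [split; lia|lia].
Qed.
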